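(* Let $\mathcal{G}$ be a noncompact tree (a noncompact metric graph containing no cycles) with nonempty compact core $\mathcal{K}$ of total length $\ell$ and with at most one pendant. Let $p\in[4,6)$ and $\mu>0$, and assume that $$\mu^{\frac{p-2}{6-p}}\,\ell<\mathcal{C}_\infty^{-p}\,\mathcal{C}_p^{\frac{4-p}{6-p}}.$$ Then there is no bound state of mass $\mu$ (for the NLS equation on $\mathcal{G}$ with nonlinearity localized on $\mathcal{K}$ and Kirchhoff conditions).
   Context: Metric graphs. A metric graph $\mathcal{G}$ is a connected multigraph (multiple edges and self-loops allowed) with finitely many edges; each edge $e$ is identified either with a bounded interval $I_e=[0,\ell_e]$, $\ell_e>0$ (bounded edge, coordinate $x_e$ with arbitrary orientation), or with $I_e=[0,+\infty)$ (half-line, attached to the graph at its vertex $x_e=0$; the point at infinity is not a vertex), the edges being joined at their endpoints, the vertices. $\mathcal{G}$ is noncompact if and only if it contains at least one half-line. The compact core $\mathcal{K}$ is the metric subgraph consisting of all bounded edges, and $\ell=\sum_{e\in\mathcal{K}}\ell_e$. A pendant is a bounded edge incident at a vertex of degree one (a half-line is never a pendant). A tree is a metric graph that contains no cycles (in particular no self-loops and no multiple edges between the same vertices). Function spaces. A function $u:\mathcal{G}\to\mathbb{C}$ is a family $\{u_e\}$ with $u_e:I_e\to\mathbb{C}$. $\|u\|_{L^p(\mathcal{G})}^p=\sum_e\|u_e\|_{L^p(I_e)}^p$. $H^1(\mathcal{G})$ is the space of continuous $u:\mathcal{G}\to\mathbb{C}$ (components agree at common vertices) with $u_e\in H^1(I_e;\mathbb{C})$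 for every edge $e$. For $\mu>0$, $H^1_\mu(\mathcal{G})=\{u\in H^1(\mathcal{G}):\|u\|_{L^2(\mathcal{G})}^2=\mu\}$. Bound states. Let $\kappa:\mathcal{G}\to\{0,1\}$ be the characteristic function of $\mathcal{K}$ and $p>2$. A bound state of mass $\mu$ is a function $u\in H^1_\mu(\mathcal{G})$ for which there is $\lambda\in\mathbb{R}$ (the Lagrange multiplier of $u$) such that $u_e''+\kappa(x)|u_e|^{p-2}u_e=\lambda u_e$ on every edge $e$, and $\sum_{e\succ \mathrm{v}}\frac{du_e}{dx_e}(\mathrm{v})=0$ for every vertex $\mathrm{v}\in\mathcal{K}$ (Kirchhoff condition), where the sum is over all edges incident at $\mathrm{v}$ and $\frac{du_e}{dx_e}(\mathrm{v})$ is $u_e'(0)$ or $-u_e'(\ell_e)$ according to whether $x_e$ equals $0$ or $\ell_e$ at $\mathrm{v}$. Constants. For $p\in[2,\infty)$, $\mathcal{C}_p>0$ and $\mathcal{C}_\infty>0$ denote universal (graph-independent) Gagliardo–Nirenberg constants, i.e. such that for every noncompact metric graph $\mathcal{G}$ and all $u\in H^1(\mathcal{G})$: $\|u\|_{L^p(\mathcal{G})}^p\le\mathcal{C}_p\|u\|_{L^2(\mathcal{G})}^{\frac p2+1}\|u'\|_{L^2(\mathcal{G})}^{\frac p2-1}$ and $\|u\|_{L^\infty(\mathcal{G})}\le\mathcal{C}_\infty\|u\|_{L^2(\mathcal{G})}^{1/2}\|u'\|_{L^2(\mathcal{G})}^{1/2}$ (one may take the constants of the half-line $[0,+\infty)$).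 *)

(* Defs.v *)
From HB Require Import structures.
From mathcomp Require Import all_boot all_order all_algebra.
From mathcomp Require Import complex.
From mathcomp Require Import all_classical all_reals all_analysis.
Import Order.TTheory GRing.Theory Num.Theory.
Import numFieldNormedType.Exports.

Set Implicit Arguments.
Unset Strict Implicit.
Unset Printing Implicit Defensive.

Local Open Scope classical_set_scope.
Local Open Scope ring_scope.

(* A dart is a bounded edge together with a direction of travel
   ([true]: from x_e = 0 to x_e = ell_e). *)
Section Multigraph.
Context {V E : finType} (src tgt : E -> V).

Definition dart_src (d : E * bool) : V := if d.2 then src d.1 else tgt d.1.
Definition dart_tgt (d : E * bool) : V := if d.2 then tgt d.1 else src d.1.

Definition adjacent : rel V :=
  fun v w => [exists d : E * bool, (dart_src d == v) && (dart_tgt d == w)].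

(* Distinct underlying edges and distinct vertices; a self-loop is a cycle of
   length 1, two parallel edges form a cycle of length 2. *)
Definition is_graph_cycle (s : seq (E * bool)) : bool :=
  [&& s != [::],
      path.cycle (fun d d' => dart_tgt d == dart_src d') s,
      uniq [seq d.1 | d <- s] &
      uniq [seq dart_src d | d <- s]].

End Multigraph.

(* Half-lines have a single vertex, at x = 0, so they are irrelevant to
   connectedness and to cycles. *)
Record metric_graph (R : realType) := MetricGraph {
  vertex : finType;
  bedge : finType;                   (* bounded edges *)
  hline : finType;                   (* half-lines *)
  len : bedge -> R;
  bsrc : bedge -> vertex;            (* the vertex at x_e = 0 *)
  btgt : bedge -> vertex;            (* the vertex at x_e = len e *)
  hroot : hline -> vertex;
  len_gt0 : forall e, 0 < len e;
  mg_connected : forall v w, connect (adjacent bsrc btgt) v w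
}.

Section MetricGraph.
Context {R : realType}.
Implicit Type G : metric_graph R.

Definition edge G : finType := (bedge G + hline G)%type.

Definition edge_itv G (e : edge G) : set R :=
  match e with
  | inl b => `[0, len b]%classic
  | inr _ => `[0, +oo[%classic
  end.

Definition noncompact G : Prop := (0 < #|hline G|)%N.

Definition nonempty_core G : Prop := (0 < #|bedge G|)%N.

Definition core_length G : R := \sum_(e : bedge G) len e.

Definition in_core G (v : vertex G) : Prop :=
  exists e : bedge G, bsrc e = v \/ btgt e = v.

(* A self-loop contributes 2. *)
Definition degree G (v : vertex G) : nat :=
  (#|[set e : bedge G | bsrc e == v]%SET| +
   #|[set e : bedge G | btgt e == v]%SET| +
   #|[set h : hline G | hroot h == v]%SET|)%N.

Definition pendant G (e : bedge G) : bool :=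
  (degree (bsrc e) == 1%N) || (degree (btgt e) == 1%N).

Definition pendants G : {set bedge G} := [set e | pendant e]%SET.

Definition is_tree G : Prop :=
  forall s : seq (bedge G * bool), ~~ is_graph_cycle (@bsrc R G) (@btgt R G) s.

End MetricGraph.

Section FunctionSpaces.
Context {R : realType}.
Implicit Types (G : metric_graph R) (I : set R).
Local Notation leb := (@lebesgue_measure R).

Local Notation normc := ComplexField.Normc.normc.

Definition restr_norm I (f : R -> R[i]) : R -> \bar R :=
  (fun x => (normc (f x))%:E) \_ I.

Definition continuous_onC I (f : R -> R[i]) : Prop :=
  {within I, continuous (fun x => complex.Re (f x))} /\
  {within I, continuous (fun x => complex.Im (f x))}.

Definition in_L2 I (f : R -> R[i]) : Prop :=
  [/\ measurable_fun I (fun x => complex.Re (f x)),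
      measurable_fun I (fun x => complex.Im (f x)) &
      ('N[leb]_(2%:E)[restr_norm I f] < +oo)%E].

(* C^infty functions with compact support in the interior of I *)
Definition test_function I (phi : R -> R) : Prop :=
  (forall n x, derivable (derive1n n phi) x 1) /\
  exists a b : R, `[a, b]%classic `<=` interior I /\
    forall x, ~ `[a, b]%classic x -> phi x = 0.

Definition weak_derivR I (f g : R -> R) : Prop :=
  forall phi, test_function I phi ->
    \int[leb]_(x in I) (f x * derive1 phi x) = - \int[leb]_(x in I) (g x * phi x).

Definition weak_derivC I (f g : R -> R[i]) : Prop :=
  weak_derivR I (fun x => complex.Re (f x)) (fun x => complex.Re (g x)) /\
  weak_derivR I (fun x => complex.Im (f x)) (fun x => complex.Im (g x)).

(* f is in H^1(I) with weak derivative g. *)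
Definition H1_interval I (f g : R -> R[i]) : Prop :=
  [/\ in_L2 I f, in_L2 I g & weak_derivC I f g].

(* Only the values of [u e] on [edge_itv e] are meaningful. *)
Definition gfun G : Type := edge G -> R -> R[i].

Definition continuous_graph G (u : gfun G) : Prop :=
  (forall e, continuous_onC (edge_itv e) (u e)) /\
  exists w : vertex G -> R[i],
    [/\ forall b : bedge G, u (inl b) 0 = w (bsrc b),
        forall b : bedge G, u (inl b) (len b) = w (btgt b) &
        forall h : hline G, u (inr h) 0 = w (hroot h)].

(* u is in H^1(G) with edgewise weak derivative du. *)
Definition H1_deriv G (u du : gfun G) : Prop :=
  continuous_graph u /\ forall e, H1_interval (edge_itv e) (u e) (du e).

Definition in_H1 G (u : gfun G) : Prop := exists du : gfun G, H1_deriv u du.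

Definition Lp_graph G (p : R) (u : gfun G) : \bar R :=
  ((\sum_(e : edge G) ('N[leb]_(p%:E)[restr_norm (edge_itv e) (u e)] `^ p))
     `^ p^-1)%E.

Definition Linfty_graph G (u : gfun G) : \bar R :=
  (\big[maxe/0]_(e : edge G) 'N[leb]_(+oo)[restr_norm (edge_itv e) (u e)])%E.

Definition in_H1_mass G (mu : R) (u : gfun G) : Prop :=
  in_H1 u /\ (Lp_graph 2 u ^+ 2 = mu%:E)%E.

End FunctionSpaces.

Section GagliardoNirenberg.
Context (R : realType).

Definition GN_constant (p C : R) : Prop :=
  0 < C /\
  forall G : metric_graph R, noncompact G ->
  forall u du : gfun G, H1_deriv u du ->
    (Lp_graph p u `^ p <=
       C%:E * Lp_graph 2 u `^ (p / 2 + 1)%R * Lp_graph 2 du `^ (p / 2 - 1)%R)%E.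

Definition GN_infty_constant (C : R) : Prop :=
  0 < C /\
  forall G : metric_graph R, noncompact G ->
  forall u du : gfun G, H1_deriv u du ->
    (Linfty_graph u <=
       C%:E * Lp_graph 2 u `^ (2^-1)%R * Lp_graph 2 du `^ (2^-1)%R)%E.

End GagliardoNirenberg.

Section BoundStates.
Context {R : realType}.
Implicit Type G : metric_graph R.
Local Notation normc := ComplexField.Normc.normc.

(* Derivative relative to I: two-sided at interior points of I, one-sided at
   the endpoints belonging to I. *)
Definition has_derivR (I : set R) (f : R -> R) (x l : R) : Prop :=
  (f y - f x) / (y - x) @[y --> within I x^'] --> l.

Definition has_derivC (I : set R) (f : R -> R[i]) (x : R) (l : R[i]) : Prop :=
  has_derivR I (fun y => complex.Re (f y)) x (complex.Re l) /\
  has_derivR I (fun y => complex.Im (f y)) x (complex.Im l).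

(* The characteristic function of the compact core (in the interior of e) *)
Definition kappa G (e : edge G) : R := if e is inl _ then 1 else 0.

(* u_e'' + kappa |u_e|^(p-2) u_e = lambda u_e; it is required in the interior
   of the edge, so that kappa is not evaluated at the vertices. *)
Definition NLS_on_edge G (p lambda : R) (u ddu : gfun G) (e : edge G) : Prop :=
  forall x, interior (edge_itv e) x ->
    ddu e x + (kappa e * normc (u e x) `^ (p - 2))%:C%C * u e x =
    lambda%:C%C * u e x.

(* A self-loop at v contributes at both of its ends. *)
Definition kirchhoff_sum G (du : gfun G) (v : vertex G) : R[i] :=
  \sum_(b : bedge G | bsrc b == v) du (inl b) 0 +
  \sum_(b : bedge G | btgt b == v) - du (inl b) (len b) +
  \sum_(h : hline G | hroot h == v) du (inr h) 0.

Definition bound_state G (p mu : R) (u : gfun G) : Prop :=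
  in_H1_mass mu u /\
  exists (lambda : R) (du ddu : gfun G),
    [/\ forall e x, edge_itv e x -> has_derivC (edge_itv e) (u e) x (du e x),
        forall e x, interior (edge_itv e) x ->
          has_derivC (edge_itv e) (du e) x (ddu e x),
        forall e, NLS_on_edge p lambda u ddu e &
        forall v, in_core v -> kirchhoff_sum du v = 0].

End BoundStates.

(* Main.v *)
Require Import Defs.
From mathcomp Require Import all_boot all_order all_algebra.
From mathcomp Require Import complex.
From mathcomp Require Import all_classical all_reals all_analysis.
From mathcomp Require Import measurable_realfun ess_sup_inf ring lra zify.
Import Order.TTheory GRing.Theory Num.Theory.
Import numFieldNormedType.Exports.

(** Suppose that u is a bound state with multiplier lambda. The sign of lambda
    decides which of two arguments excludes it.

    If lambda <= 0, no nonzero solution of f'' = lambda f on a half-line is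
    square integrable ([halfline_vanish]), so u is zero on every half-line.
    This propagates into the compact core: at a vertex where all the edges but
    one carry the zero function, continuity and the Kirchhoff condition make u
    and its derivative vanish at that end of the remaining edge, and uniqueness
    for the Cauchy problem ([linear_ODE_unique]) makes u vanish on it. So if u
    were nonzero on some bounded edge, a walk through edges on which u is
    nonzero that never reverses could stop only at a vertex of degree one
    ([stuck_degree1]). With at most one pendant, a walk that starts at such a
    vertex (or anywhere, if there is none) continues until it meets itself, and
    this closes a cycle ([nonbacktracking_walk_cycle]), which a tree does not
    have. Hence u = 0, against mu > 0.

    If lambda >= 0, multiply the equation by the conjugate of u and integrate.
    The boundary terms cancel by the Kirchhoff conditions, and
      |u'|_2^2 + lambda |u|_2^2 = |u|_{L^p(K)}^p,
    of which only the inequality |u'|_2^2 <= |u|_{L^p(K)}^p ([energy_le]) is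
    kept. Write D = |u'|_2. The first Gagliardo-Nirenberg inequality bounds the
    right-hand side by C_p mu^{(p+2)/4} D^{(p-2)/2}, hence bounds D from above;
    the second bounds it by l C_oo^p mu^{p/4} D^{p/2}, hence bounds D^{(p-4)/2}
    from below. Eliminating D, where p >= 4 gives the right monotonicity,
    yields the reverse of the smallness assumption ([GN_incompatible]).

    The derivatives of a bound state are only assumed to exist pointwise. They
    are first shown to be continuous up to the endpoints of the edges
    ([C1_on_has_deriv]); this is what makes the fundamental theorem of calculus
    available on closed edges, and shows that they are also weak derivatives. *)

Set Implicit Arguments.
Unset Strict Implicit.
Unset Printing Implicit Defensive.

Local Open Scope classical_set_scope.
Local Open Scope ring_scope.

(** * Functions of class C^1 on a closed interval *)
Section RealAnalysis.
Context {R : realType}.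
Implicit Types (f g : R -> R) (a b x l : R).

(** The increment form avoids division, so the case y = x needs no exception. *)
Lemma has_derivR_eps (I : set R) f x l : has_derivR I f x l -> forall e, 0 < e ->
  exists2 d, 0 < d & forall y, I y -> `|x - y| < d ->
    `|f y - f x - l * (y - x)| <= e * `|y - x|.
Proof.
move=> /cvgrPdist_lt fl e e0; have := fl e e0.
rewrite near_withinE near_withinE => -[d /= d0 dP].
exists d => // y Iy xyd; have [->|yx] := eqVneq y x.
  by rewrite !subrr mulr0 subrr normr0 mulr0.
have /ltW := dP y xyd yx Iy.
have yx0 : y - x != 0 by rewrite subr_eq0.
rewrite -(ler_pM2r (_ : 0 < `|y - x|)) ?normr_gt0//.
by rewrite -normrM mulrBl divfK// distrC.
Qed.

Lemma has_derivR_is_derive (I : set R) f x l :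
  interior I x -> has_derivR I f x l -> is_derive x 1 f l.
Proof.
move=> Ix /has_derivR_eps fl.
apply/is_derive1_caratheodory.
pose g z := if z == x then l else (f z - f x) / (z - x).
have gx : g x = l by rewrite /g eqxx.
exists g; split => //.
- move=> z; rewrite /g; case: eqVneq => [->|zx]; first by rewrite !subrr mulr0.
  by rewrite divfK// subr_eq0.
- apply/cvgrPdist_le => e e0; rewrite gx.
  have [d d0 dP] := fl e e0.
  near=> y; rewrite /g; case: eqVneq => [yx|yx]; first by rewrite subrr normr0 ltW.
  have yx0 : 0 < `|y - x| by rewrite normr_gt0 subr_eq0.
  rewrite -(ler_pM2r yx0) -normrM mulrBl divfK ?subr_eq0// distrC.
  apply: dP; first by near: y; exact: Ix.
  by near: y; apply: (nbhsx_ballx x d).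
Unshelve. all: by end_near. Qed.

Lemma has_derivR_continuous (I : set R) f f' :
  (forall x, I x -> has_derivR I f x (f' x)) -> {within I, continuous f}.
Proof.
move=> fl; apply/subspace_continuousP => x Ix.
apply/cvgrPdist_le => e e0.
have [d d0 dP] := has_derivR_eps (fl x Ix) ltr01.
rewrite near_withinE; near=> y => Iy.
have : `|f y - f x - f' x * (y - x)| <= 1 * `|y - x|.
  by apply: dP => //; near: y; apply: (nbhsx_ballx x d).
rewrite mul1r => h.
have -> : f x - f y = - ((f y - f x - f' x * (y - x)) + f' x * (y - x)) by ring.
rewrite normrN (le_trans (ler_normD _ _))//.
rewrite normrM; apply: (@le_trans _ _ ((1 + `|f' x|) * `|y - x|)).
  by rewrite mulrDl mul1r lerD.
have M1 : 0 < 1 + `|f' x| by rewrite ltr_pwDl.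
rewrite mulrC -ler_pdivlMr// distrC ltW//.
near: y; apply: (nbhsx_ballx x (e / (1 + `|f' x|))).
by rewrite divr_gt0.
Unshelve. all: by end_near. Qed.

Lemma has_derivR_sub (I J : set R) f x l :
  J `<=` I -> has_derivR I f x l -> has_derivR J f x l.
Proof.
move=> JI; apply: cvg_trans; apply: cvg_app.
by move=> A [/= d d0 dP]; exists d => // y xy yx Jy; apply: dP => //; exact: JI.
Qed.

(** Two-sided derivatives are required only inside the interval; continuity of
    f and f' up to the endpoints replaces one-sided derivatives there. In this
    form the predicate is stable under sums and products, and it gives the
    fundamental theorem of calculus on the closed interval. *)
Definition C1_on a b f f' : Prop :=
  [/\ {within `[a, b], continuous f}, {within `[a, b], continuous f'} &
      forall x, x \in `]a, b[ -> is_derive x 1 f (f' x)].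

Lemma C1_onD a b f f' g g' : C1_on a b f f' -> C1_on a b g g' ->
  C1_on a b (f \+ g) (f' \+ g').
Proof.
move=> [cf cf' df] [cg cg' dg]; split.
- by move=> x; apply: cvgD; [exact: cf|exact: cg].
- by move=> x; apply: cvgD; [exact: cf'|exact: cg'].
- by move=> x xab; apply: is_deriveD; [exact: df|exact: dg].
Qed.

Lemma C1_onM a b f f' g g' : C1_on a b f f' -> C1_on a b g g' ->
  C1_on a b (f \* g) (fun x => f x * g' x + f' x * g x).
Proof.
move=> [cf cf' df] [cg cg' dg]; split.
- by move=> x; apply: cvgM; [exact: cf|exact: cg].
- by move=> x; apply: cvgD; apply: cvgM;
    [exact: cf|exact: cg'|exact: cf'|exact: cg].
- move=> x xab; have dfx := df x xab; have dgx := dg x xab.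
  by apply: is_derive_eq; rewrite /GRing.scale/= (mulrC (f' x)).
Qed.

Lemma C1_onZ a b k f f' : C1_on a b f f' ->
  C1_on a b (fun x => k * f x) (fun x => k * f' x).
Proof.
move=> [cf cf' df]; split.
- by move=> x; apply: cvgM; [exact: cvg_cst|exact: cf].
- by move=> x; apply: cvgM; [exact: cvg_cst|exact: cf'].
- move=> x xab; have dfx := df x xab; exact: is_deriveZ.
Qed.

Lemma C1_on_global a b f f' : (forall x, is_derive x 1 f (f' x)) ->
  continuous f' -> C1_on a b f f'.
Proof.
move=> df cf'; split.
- apply: continuous_subspaceT => x.
  by apply/differentiable_continuous/derivable1_diffP; case: (df x).
- exact: continuous_subspaceT.
- by move=> x _; exact: df.
Qed.

Lemma C1_on_le a b f f' : a <= b -> C1_on a b f f' ->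
  (forall x, x \in `]a, b[ -> 0 <= f' x) -> f a <= f b.
Proof.
move=> ab [cf _ df] f'0; apply: (@ger0_derive1_le_cc _ f a b) => //.
- by move=> x /df [].
- by move=> x xab; rewrite derive1E; have [_ ->] := df x xab; exact: f'0.
- by rewrite in_itv/= lexx.
- by rewrite in_itv/= lexx andbT.
Qed.

Lemma sub_within_itv a b c d f : a <= c -> d <= b ->
  {within `[a, b], continuous f} -> {within `[c, d], continuous f}.
Proof.
move=> ac db; apply: continuous_subspaceW => x /=; rewrite !in_itv/= => /andP[cx xd].
by rewrite (le_trans ac cx) (le_trans xd db).
Qed.

Lemma C1_on_sub a b c d f f' : a <= c -> d <= b ->
  C1_on a b f f' -> C1_on c d f f'.
Proof.
move=> ac db [cf cf' df]; split; [exact: sub_within_itv cf|exact: sub_within_itv cf'|].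
move=> x; rewrite in_itv/= => /andP[cx xd]; apply: df.
by rewrite in_itv/= (le_lt_trans ac cx) (lt_le_trans xd db).
Qed.

Lemma C1_on_FTC a b f f' : a < b -> C1_on a b f f' ->
  (\int[lebesgue_measure]_(x in `[a, b]) (f' x)%:E = (f b - f a)%:E)%E.
Proof.
move=> ab [cf cf' df]; rewrite (@continuous_FTC2 _ f' f)//; first last.
- by move=> x /df fx; rewrite derive1E; case: fx.
have /(continuous_within_itvP _ ab) [ci ca cb] := cf.
by split => // x /df [].
Qed.

Lemma C1_on_ext a b f g f' g' : f =1 g -> f' =1 g' ->
  C1_on a b f f' -> C1_on a b g g'.
Proof. by move=> /funext-> /funext->. Qed.

(** If f has one-sided derivatives at the endpoints and f'' is bounded inside,
    then f' is Lipschitz on the closed interval. By the mean value theorem f' is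
    Lipschitz inside; an endpoint is reached because the derivative there is a
    limit of difference quotients, each of which is a value of f' at a nearby
    interior point, again by the mean value theorem. *)
Lemma C1_on_has_deriv a b f f' g M : a < b ->
  (forall x, x \in `[a, b] -> has_derivR `[a, b] f x (f' x)) ->
  (forall x, x \in `]a, b[ -> is_derive x 1 f' (g x)) ->
  (forall x, x \in `]a, b[ -> `|g x| <= M) -> C1_on a b f f'.
Proof.
move=> ab fd f'd gM.
have cf : {within `[a, b], continuous f} by exact: has_derivR_continuous fd.
have dfi x : x \in `]a, b[ -> is_derive x 1 f (f' x).
  move=> xab; apply: (@has_derivR_is_derive `[a, b]).
    by rewrite interior_itv.
  by apply: fd; apply: subset_itv_oo_cc.
have lip x y : x \in `]a, b[ -> y \in `]a, b[ -> x <= y -> `|f' y - f' x| <= M * (y - x).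
  move=> xab yab; rewrite le_eqVlt => /predU1P[->|xy]; first by rewrite !subrr normr0 mulr0.
  have sub z : z \in `[x, y] -> z \in `]a, b[.
    rewrite !in_itv/= => /andP[xz zy].
    by rewrite (lt_le_trans _ xz) ?(itvP xab)// (le_lt_trans zy) ?(itvP yab).
  have f'dxy z : z \in `]x, y[ -> is_derive z 1 f' (g z).
    by move=> zxy; apply: f'd; apply: sub; apply: subset_itv_oo_cc zxy.
  have [|c cxy fE] := @MVT _ f' g x y xy f'dxy.
    apply: derivable_within_continuous => z /sub zab.
    by have [] := f'd z zab.
  have yx0 : 0 <= y - x by rewrite subr_ge0 ltW.
  rewrite fE normrM (ger0_norm yx0) ler_wpM2r//; apply: gM; apply: sub.
  exact: subset_itv_oo_cc cxy.
(* values of f' at interior points approximate f' x, also when x is an endpoint *)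
have quot x : x \in `[a, b] -> forall e, 0 < e -> exists2 z, z \in `]a, b[ &
    `|z - x| < e /\ `|f' z - f' x| < e.
  move=> xab e e0.
  have e20 : 0 < e / 2 by rewrite divr_gt0.
  have [d d0 dP] := has_derivR_eps (fd x xab) e20.
  pose h := Num.min (Num.min d e / 2) ((b - a) / 2).
  have h0 : 0 < h by rewrite lt_min !divr_gt0// ?lt_min ?d0// subr_gt0.
  have hd : h < d.
    rewrite gt_min; apply/orP; left; rewrite ltr_pdivrMr// gt_min ltr_pMr//.
    by rewrite ltr1n.
  have he : h < e.
    rewrite gt_min; apply/orP; left; rewrite ltr_pdivrMr// gt_min orbC ltr_pMr//.
    by rewrite ltr1n.
  have hab : h <= (b - a) / 2 by rewrite ge_min lexx orbT.
  (* the step h goes towards the farther endpoint, which h <= (b - a) / 2 never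
     overshoots *)
  have [xm|xm] := leP x ((a + b) / 2).
  - have xh : x < x + h by rewrite ltrDl.
    have ax : a <= x by rewrite (itvP xab).
    have xhb : x + h <= b by lra.
    have sub z : z \in `]x, (x + h)[ -> z \in `]a, b[.
      by rewrite !in_itv/= => /andP[? ?]; apply/andP; split; lra.
    have dfh z (zx : z \in `]x, (x + h)[) := dfi z (sub z zx).
    have [|c cxy fE] := @MVT _ f f' x (x + h) xh dfh.
      exact: sub_within_itv cf.
    exists c; first exact: sub.
    have := cxy; rewrite in_itv/= => /andP[xc cxh].
    split; first by rewrite gtr0_norm; lra.
    have : `|f (x + h) - f x - f' x * (x + h - x)| <= e / 2 * `|x + h - x|.
      apply: dP; first by rewrite /= in_itv/=; apply/andP; split; lra.
      by rewrite opprD addrA subrr add0r normrN gtr0_norm.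
    rewrite fE -mulrBl normrM ler_pM2r ?normr_gt0 ?subr_eq0 ?gt_eqF//; lra.
  - have xh : x - h < x by rewrite ltrBlDr ltrDl.
    have ax : x <= b by rewrite (itvP xab).
    have xhb : a <= x - h by lra.
    have sub z : z \in `](x - h), x[ -> z \in `]a, b[.
      by rewrite !in_itv/= => /andP[? ?]; apply/andP; split; lra.
    have dfh z (zx : z \in `](x - h), x[) := dfi z (sub z zx).
    have [|c cxy fE] := @MVT _ f f' (x - h) x xh dfh.
      exact: sub_within_itv cf.
    exists c; first exact: sub.
    have := cxy; rewrite in_itv/= => /andP[xc cxh].
    split; first by rewrite ltr0_norm; lra.
    have : `|f (x - h) - f x - f' x * (x - h - x)| <= e / 2 * `|x - h - x|.
      apply: dP; first by rewrite /= in_itv/=; apply/andP; split; lra.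
      by rewrite opprB addrC subrK gtr0_norm.
    rewrite -(opprB (f x)) fE.
    have -> : - (f' c * (x - (x - h))) - f' x * (x - h - x) =
      (f' c - f' x) * (x - h - x) by ring.
    rewrite normrM ler_pM2r ?normr_gt0 ?subr_eq0 ?lt_eqF//; lra.
have M0 : 0 <= M.
  have mab : (a + b) / 2 \in `]a, b[ by rewrite in_itv/=; apply/andP; split; lra.
  exact: le_trans (gM _ mab).
have lip' x y : x \in `[a, b] -> y \in `[a, b] -> `|f' y - f' x| <= M * `|y - x|.
  move=> xab yab; apply/ler_addgt0Pr => e e0.
  (* replacing x and y by nearby interior points costs e' for each of the two
     derivatives and 2 * M * e' in the Lipschitz bound, which makes e in all *)
  pose e' := e / (2 + 2 * M).
  have e'0 : 0 < e' by rewrite divr_gt0//; lra.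
  have [x1 x1ab [xx1 fx1]] := quot x xab e' e'0.
  have [y1 y1ab [yy1 fy1]] := quot y yab e' e'0.
  have l1 : `|f' y1 - f' x1| <= M * `|y1 - x1|.
    have [xy|/ltW xy] := leP x1 y1.
      by rewrite (ger0_norm (_ : 0 <= y1 - x1)) ?subr_ge0// lip.
    by rewrite distrC (distrC y1) (ger0_norm (_ : 0 <= x1 - y1)) ?subr_ge0// lip.
  have l2 : `|y1 - x1| <= `|y - x| + 2 * e'.
    have -> : y1 - x1 = (y1 - y) + (y - x) - (x1 - x) by ring.
    rewrite (le_trans (ler_normB _ _))// (le_trans (lerD (ler_normD _ _) (lexx _)))//; lra.
  have -> : f' y - f' x = - (f' y1 - f' y) + (f' y1 - f' x1) + (f' x1 - f' x) by ring.
  rewrite (le_trans (ler_normD _ _))// (le_trans (lerD (ler_normD _ _) (lexx _)))//.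
  rewrite normrN.
  have ee : (2 + 2 * M) * e' = e by rewrite /e' mulrC divfK// gt_eqF//; lra.
  have : M * `|y1 - x1| <= M * (`|y - x| + 2 * e') by rewrite ler_wpM2l.
  rewrite mulrDr; nra.
have M1 : 0 < M + 1 by lra.
split => //; apply/subspace_continuousP => x xab; apply/cvgrPdist_lt => e e0.
rewrite near_withinE; near=> y => yab.
rewrite distrC (le_lt_trans (lip' x y xab yab))//.
apply: (@le_lt_trans _ _ ((M + 1) * `|y - x|)).
  by rewrite ler_wpM2r//; lra.
rewrite mulrC -ltr_pdivlMr//.
rewrite distrC.
near: y; apply: (nbhsx_ballx x (e / (M + 1))).
by apply: divr_gt0; [exact: e0|exact: M1].
Unshelve. all: by end_near. Qed.

End RealAnalysis.

(** * Gronwall estimates and uniqueness for linear equations *)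
Section ODE.
Context {R : realType}.
Notation mu := (@lebesgue_measure R).
Implicit Types (f g q F : R -> R) (a b c l s x : R).

(** F multiplied by the integrating factor exp (- c x) is nonincreasing. *)
Lemma Gronwall_le a b c F (F' : R -> R) : a < b -> C1_on a b F F' ->
  (forall x, x \in `]a, b[ -> F' x <= c * F x) ->
  F b * expR (- c * b) <= F a * expR (- c * a).
Proof.
move=> ab CF F'F.
have Ce : C1_on a b (fun x => expR (- c * x)) (fun x => - c * expR (- c * x)).
  apply: C1_on_global => [x|x].
    apply: is_derive_eq.
    by rewrite /GRing.scale/= mulr1 mulrC.
  apply: cvgM; first exact: cvg_cst.
  apply: continuous_comp; last exact: continuous_expR.
  by apply: cvgM; [exact: cvg_cst|exact: cvg_id].
have := C1_onZ (-1) (C1_onM CF Ce) => /(C1_on_le (ltW ab)).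
rewrite !mulN1r lerN2; apply => x xab.
have e0 := expR_gt0 (- c * x); rewrite mulN1r oppr_ge0.
have -> : F x * (- c * expR (- c * x)) + F' x * expR (- c * x) =
  (F' x - c * F x) * expR (- c * x) by ring.
by rewrite pmulr_lle0// subr_le0 F'F.
Qed.

Lemma Gronwall_ge a b c F (F' : R -> R) : a < b -> C1_on a b F F' ->
  (forall x, x \in `]a, b[ -> c * F x <= F' x) ->
  F a * expR (- c * a) <= F b * expR (- c * b).
Proof.
move=> ab CF F'F; have := @Gronwall_le a b c _ _ ab (C1_onZ (-1) CF).
rewrite -!mulrA !mulN1r lerN2; apply => x xab.
by rewrite !mulN1r mulrN lerN2 F'F.
Qed.

(** With r = f, t = f' and k = q the left-hand side is the derivative of
    f^2 + f'^2 along f'' = q f; this is the differential inequality that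
    Gronwall's argument needs, in both directions of travel. *)
Lemma linear_ODE_energy_bound (r s t k : R) : `|k| <= s ->
  `|2 * (1 + k) * (r * t)| <= (1 + s) * (r ^+ 2 + t ^+ 2).
Proof.
move=> ks; rewrite mulrAC normrM mulrC.
have h1 : `|1 + k| <= 1 + s by rewrite (le_trans (ler_normD _ _))// normr1 lerD2l.
apply: ler_pM => //.
rewrite normrM normrM ger0_norm//.
rewrite -(real_normK (num_real r)) -(real_normK (num_real t)) -subr_ge0.
have -> : `|r| ^+ 2 + `|t| ^+ 2 - 2 * (`|r| * `|t|) = (`|r| - `|t|) ^+ 2 by ring.
exact: sqr_ge0.
Qed.

(** Cauchy data may be given at either end, since a dart can be travelled in
    both directions. The energy f^2 + f'^2 vanishes at that end and grows at
    most exponentially away from it. *)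
Lemma linear_ODE_unique l q f f' s : 0 < l ->
  C1_on 0 l f f' -> C1_on 0 l f' (fun x => q x * f x) ->
  (forall x, x \in `]0, l[ -> `|q x| <= s) ->
  (f 0 = 0 /\ f' 0 = 0) \/ (f l = 0 /\ f' l = 0) ->
  forall x, x \in `[0, l] -> f x = 0 /\ f' x = 0.
Proof.
move=> l0 Cf Cf' qs init.
have CF := C1_onD (C1_onM Cf Cf) (C1_onM Cf' Cf').
have bd x : x \in `]0, l[ ->
    `|f x * f' x + f' x * f x + (f' x * (q x * f x) + q x * f x * f' x)| <=
    (1 + s) * (f x * f x + f' x * f' x).
  move=> xl; rewrite -!expr2 [X in `|X|](_ : _ = 2 * (1 + q x) * (f x * f' x)); last by ring.
  exact/linear_ODE_energy_bound/qs.
suff F0 x : x \in `[0, l] -> f x * f x + f' x * f' x <= 0.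
  move=> x /F0; rewrite -!expr2 => h.
  have h1 := sqr_ge0 (f x); have h2 := sqr_ge0 (f' x).
  by split; apply/eqP; rewrite -sqrf_eq0; apply/eqP; lra.
rewrite in_itv/= => /andP[x0 xl].
case: init => -[i0 i1].
- move: x0; rewrite le_eqVlt => /predU1P[<-|x0]; first by rewrite i0 i1 mulr0 addr0.
  have := @Gronwall_le 0 x (1 + s) _ _ x0 (C1_on_sub (lexx _) xl CF).
  rewrite /= i0 i1 !mul0r add0r mul0r pmulr_lle0 ?expR_gt0//; apply => y.
  rewrite in_itv/= => /andP[y0 yx].
  by apply: le_trans (ler_norm _) (bd y _); rewrite in_itv/= y0 (lt_le_trans yx).
- move: xl; rewrite le_eqVlt => /predU1P[->|xl]; first by rewrite i0 i1 mulr0 addr0.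
  have := @Gronwall_ge x l (- (1 + s)) _ _ xl (C1_on_sub x0 (lexx _) CF).
  rewrite /= i0 i1 !mul0r add0r mul0r pmulr_lle0 ?expR_gt0//; apply => y.
  rewrite in_itv/= => /andP[y0 yx].
  have yl : y \in `]0, l[ by rewrite in_itv/= yx (le_lt_trans x0 y0).
  by rewrite mulNr; have := bd y yl; rewrite ler_norml => /andP[].
Qed.
End ODE.

(** * Square integrable solutions on a half-line *)
Section HalfLine.
Context {R : realType}.
Notation mu := (@lebesgue_measure R).
Implicit Types (f q F : R -> R) (a b c x lam : R).

Lemma C1_on_eq a b f f' : a <= b -> C1_on a b f f' ->
  (forall x, x \in `]a, b[ -> f' x = 0) -> f a = f b.
Proof.
move=> ab Cf f0; apply/eqP; rewrite eq_le; apply/andP; split.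
  by apply: (C1_on_le ab Cf) => x /f0 ->.
have := C1_on_le ab (C1_onZ (-1) Cf); rewrite !mulN1r lerN2; apply => x /f0 ->.
by rewrite mulr0.
Qed.

Lemma C1_on_halfline_continuous f f' : (forall T : R, 0 < T -> C1_on 0 T f f') ->
  {within `[0, +oo[, continuous f} /\ {within `[0, +oo[, continuous f'}.
Proof.
have aux (g : R -> R) : (forall T : R, 0 < T -> {within `[0, T], continuous g}) ->
    {within `[0, +oo[, continuous g}.
  move=> cg; apply/continuous_within_itvcyP; split; last first.
    by have /(continuous_within_itvP _ ltr01) [] := cg 1 ltr01.
  move=> x; rewrite in_itv/= andbT => x0.
  have x10 : 0 < x + 1 by rewrite addr_gt0.
  have /(continuous_within_itvP _ x10) [+ _ _] := cg _ x10.
  by apply; rewrite in_itv/= x0 ltrDl ltr01.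
by move=> Cf; split; apply: aux => T /Cf [].
Qed.

Lemma measurable_sqr (I : set R) f : measurable_fun I f ->
  measurable_fun I (fun x => (f x ^+ 2)%:E).
Proof. by move=> mf; apply/measurable_EFinP; exact: measurable_funX. Qed.

Lemma not_sqr_integrable f c x1 : 0 <= x1 -> 0 < c ->
  measurable_fun (`[0, +oo[%classic : set R) f ->
  (\int[mu]_(x in `[0%R, +oo[) (f x ^+ 2)%:E < +oo)%E ->
  (forall x, x1 <= x -> c <= f x ^+ 2) -> False.
Proof.
move=> x10 c0 mf fi fc.
have sub : `[x1, +oo[ `<=` `[0, +oo[%classic.
  by move=> x /=; rewrite !in_itv/= !andbT; exact: le_trans.
have mf2 := measurable_sqr mf.
suff : (+oo <= \int[mu]_(x in `[0%R, +oo[) (f x ^+ 2)%:E)%E by rewrite leNgt fi.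
apply: (@le_trans _ _ (\int[mu]_(x in `[x1, +oo[) (f x ^+ 2)%:E)%E); last first.
  by apply: ge0_subset_integral => // x _; rewrite lee_fin sqr_ge0.
apply: (@le_trans _ _ (\int[mu]_(x in `[x1, +oo[) (cst c%:E x))%E).
  rewrite integral_cst//= lebesgue_measure_itv/= ltry.
  by rewrite addye// gt0_muley ?lte_fin.
apply: ge0_le_integral => //.
- by move=> x _; rewrite lee_fin ltW.
- exact: measurable_funS mf2.
- by move=> x /=; rewrite in_itv/= andbT lee_fin; exact: fc.
Qed.

Definition halfline_sol lam f f' := forall T : R, 0 < T ->
  C1_on 0 T f f' /\ C1_on 0 T f' (fun x => lam * f x).

(** Since (f^2)' = 2 f f' >= 2 c, the function f^2 grows at least linearly, which
    is incompatible with integrability. The criterion serves for both signs of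
    the multiplier. *)
Lemma halfline_growth f f' c x0 : 0 <= x0 -> 0 < c ->
  (forall T : R, 0 < T -> C1_on 0 T f f') ->
  (\int[mu]_(x in `[0%R, +oo[) (f x ^+ 2)%:E < +oo)%E ->
  (forall x, x0 <= x -> c <= f x * f' x) -> False.
Proof.
move=> x00 c0 Cf fi fc.
have [cf _] := C1_on_halfline_continuous Cf.
apply: (@not_sqr_integrable f (2 * c) (x0 + 1)) => //.
- exact: addr_ge0.
- by rewrite mulr_gt0.
- exact: subspace_continuous_measurable_fun.
move=> x x0x.
have x0' : x0 <= x by lra.
have xp : 0 < x by lra.
have Cid : C1_on x0 x (fun y => - (2 * c) * y) (fun=> - (2 * c)).
  apply: C1_on_global => y; last exact: cvg_cst.
  by apply: is_derive_eq; rewrite /GRing.scale/= mulr1.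
have CF := C1_onD (C1_on_sub x00 (lexx x) (C1_onM (Cf x xp) (Cf x xp))) Cid.
have := C1_on_le x0' CF => /=.
rewrite -!expr2 => h.
have {}h : f x0 ^+ 2 + - (2 * c) * x0 <= f x ^+ 2 + - (2 * c) * x.
  apply: h => y; rewrite in_itv/= => /andP[x0y _].
  by have := fc y (ltW x0y); lra.
have := sqr_ge0 (f x0); nra.
Qed.

Lemma halfline_product lam f f' T : halfline_sol lam f f' -> 0 < T ->
  C1_on 0 T (fun x => f x * f' x) (fun x => f' x ^+ 2 + lam * f x ^+ 2).
Proof.
move=> sf T0; have [Cf Cf'] := sf T T0.
by apply: C1_on_ext (C1_onM Cf Cf') => x //=; ring.
Qed.

(** For lam >= 0 the product f f' is nondecreasing, because its derivative is
    f'^2 + lam f^2; were it positive somewhere, it would stay bounded below by a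
    positive constant. *)
Lemma halfline_product_le0 lam f f' x : 0 <= lam -> halfline_sol lam f f' ->
  (\int[mu]_(x in `[0%R, +oo[) (f x ^+ 2)%:E < +oo)%E ->
  0 <= x -> f x * f' x <= 0.
Proof.
move=> lam0 sf fi x0; rewrite leNgt; apply/negP => c0.
apply: (@halfline_growth f f' _ x x0 c0) => //.
  by move=> T T0; have [] := sf T T0.
move=> y; rewrite le_eqVlt => /predU1P[->//|xy].
have y0 : 0 < y by exact: le_lt_trans xy.
have := C1_on_le (ltW xy) (C1_on_sub x0 (lexx _) (halfline_product sf y0)).
by apply => z _; rewrite addr_ge0 ?sqr_ge0// mulr_ge0 ?sqr_ge0.
Qed.

(** On [0, T] the fundamental theorem of calculus for f f' gives the bound
    f T f' T - f 0 f' 0, and f T f' T <= 0; then T tends to infinity. *)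
Lemma halfline_energy lam f f' : 0 <= lam -> halfline_sol lam f f' ->
  (\int[mu]_(x in `[0%R, +oo[) (f x ^+ 2)%:E < +oo)%E ->
  (\int[mu]_(x in `[0%R, +oo[) (f' x ^+ 2)%:E <= (- (f 0 * f' 0))%:E)%E.
Proof.
move=> lam0 sf fi.
have [cf cf'] : {within `[0, +oo[, continuous f} /\ {within `[0, +oo[, continuous f'}.
  by apply: C1_on_halfline_continuous => T T0; have [] := sf T T0.
have mf'2 : measurable_fun (`[0, +oo[%classic : set R) (fun x => (f' x ^+ 2)%:E).
  by apply: measurable_sqr; exact: subspace_continuous_measurable_fun.
have sub (T : R) : `[0, T]%classic `<=` `[0%R, +oo[%classic.
  by move=> x /=; rewrite !in_itv/= andbT => /andP[].
have key T : 0 < T -> (\int[mu]_(x in `[0%R, T]) (f' x ^+ 2)%:E <= (- (f 0 * f' 0))%:E)%E.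
  move=> T0; have CW := halfline_product sf T0.
  apply: (@le_trans _ _ (\int[mu]_(x in `[0%R, T]) (f' x ^+ 2 + lam * f x ^+ 2)%:E)%E).
    apply: ge0_le_integral => //.
    - by move=> x _; rewrite lee_fin sqr_ge0.
    - exact: measurable_funS mf'2.
    - apply/measurable_EFinP; apply: subspace_continuous_measurable_fun => //.
      by case: CW.
    - by move=> x _; rewrite lee_fin lerDl mulr_ge0// sqr_ge0.
  rewrite (C1_on_FTC T0 CW) lee_fin lerBlDr addrC subrr.
  exact: halfline_product_le0 sf fi (ltW T0).
have cv : (\int[mu]_(x in `[0%R, (0 + n%:R)%R]) (f' x ^+ 2)%:E)%E @[n --> \oo] -->
    (\int[mu]_(x in \bigcup_n `[0%R, (0 + n%:R)%R]%classic) (f' x ^+ 2)%:E)%E.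
  apply: ge0_nondecreasing_set_cvg_integral => //.
  - move=> n m nm; rewrite subsetEset => x /=; rewrite !in_itv/= => /andP[->/= h].
    by rewrite (le_trans h)// lerD2l ler_nat.
  - by move=> i; exact: measurable_funS mf'2.
  - by move=> i x _; rewrite lee_fin sqr_ge0.
rewrite itv_bndy_bigcup_BRight -(cvg_lim _ cv)//.
apply: lime_le; first exact: cvgP cv.
near=> n; rewrite add0r; apply: key; rewrite ltr0n; near: n; exact: nbhs_infty_gt.
Unshelve. all: by end_near. Qed.

(** Conservation of the mechanical energy of f'' = lam f. *)
Lemma halfline_energy_cst lam f f' x : halfline_sol lam f f' -> 0 <= x ->
  f' 0 ^+ 2 - lam * f 0 ^+ 2 = f' x ^+ 2 - lam * f x ^+ 2.
Proof.
move=> sf; rewrite le_eqVlt => /predU1P[->//|x0]; have [Cf Cf'] := sf x x0.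
have := C1_on_eq (ltW x0) (C1_onD (C1_onM Cf' Cf') (C1_onZ (- lam) (C1_onM Cf Cf))).
by rewrite /= -!expr2 -!mulNr; apply => y _; ring.
Qed.

(** Let E = f'^2 - lam f^2 >= 0 be the conserved energy. As
    (f f')' = f'^2 + lam f^2 = E + 2 lam f^2 and f^2 is integrable, f f' differs
    from E T by a bounded quantity; E > 0 would thus force f f' to grow, against
    [halfline_growth]. If E = 0 then f' = 0, and a square integrable constant
    is 0. *)
Lemma halfline_vanish lam f f' : lam <= 0 -> halfline_sol lam f f' ->
  (\int[mu]_(x in `[0%R, +oo[) (f x ^+ 2)%:E < +oo)%E ->
  forall x, 0 <= x -> f x = 0 /\ f' x = 0.
Proof.
move=> lam0 sf fi; have Cf T (T0 : 0 < T) := (sf T T0).1.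
have [cf _] := C1_on_halfline_continuous Cf.
have mf : measurable_fun (`[0, +oo[%classic : set R) f.
  exact: subspace_continuous_measurable_fun.
have mf2 := measurable_sqr mf.
set E := f' 0 ^+ 2 - lam * f 0 ^+ 2.
have EE x : 0 <= x -> E = f' x ^+ 2 - lam * f x ^+ 2 by exact: halfline_energy_cst.
have E_le0 : E <= 0.
  rewrite leNgt; apply/negP => E0.
  set S := (\int[mu]_(x in `[0%R, +oo[) (f x ^+ 2)%:E)%E in fi.
  have S0 : (0 <= S)%E by apply: integral_ge0 => x _; rewrite lee_fin sqr_ge0.
  have Sfin : S \is a fin_num by rewrite ge0_fin_numE.
  have key T : 0 < T -> E * T + (f 0 * f' 0 - - 2 * lam * fine S) <= f T * f' T.
    move=> T0; have CW := halfline_product sf T0.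
    have Cid : C1_on 0 T (fun y => E * y) (fun=> E).
      apply: C1_on_global => y; last exact: cvg_cst.
      by apply: is_derive_eq; rewrite /GRing.scale/= mulr1.
    have /(C1_on_FTC T0) := C1_onD Cid (C1_onZ (-1) CW).
    rewrite /= mulr0 add0r !mulN1r opprK => h.
    have : ((E * T - f T * f' T + f 0 * f' 0)%:E <= (- 2 * lam)%:E * S)%E.
      rewrite -h (_ : (\int[mu]_(x in `[0%R, T]) _ = (- 2 * lam)%:E *
          \int[mu]_(x in `[0%R, T]) (f x ^+ 2)%:E)%E).
        apply: lee_wpmul2l; first by rewrite lee_fin; lra.
        apply: ge0_subset_integral => //.
        - by move=> x _; rewrite lee_fin sqr_ge0.
        - by move=> x /=; rewrite !in_itv/= andbT => /andP[].
      rewrite -ge0_integralZl_EFin//; last 3 first.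
      - by move=> x _; rewrite lee_fin sqr_ge0.
      - apply: measurable_funS mf2 => // x /=; rewrite !in_itv/= andbT => /andP[]//.
      - by lra.
      apply: eq_integral => x; rewrite inE/= in_itv/= => /andP[x0 _].
      by rewrite -EFinM (EE x x0); congr EFin; ring.
    by rewrite -(fineK Sfin) -EFinM lee_fin; lra.
  set K := f 0 * f' 0 - - 2 * lam * fine S in key *.
  (* beyond (1 + |K|) / E the lower bound E * x + K of f f' exceeds 1 *)
  apply: (@halfline_growth f f' 1 ((1 + `|K|) / E)) => //.
    by apply: divr_ge0; [have := normr_ge0 K; lra|exact: ltW].
  move=> x; rewrite ler_pdivrMr// => xE.
  have x0 : 0 < x.
    rewrite -(pmulr_lgt0 _ E0); apply: lt_le_trans xE.
    by have := normr_ge0 K; lra.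
  apply: le_trans (key x x0).
  have := ler_norm (- K); rewrite normrN; lra.
have f'0 x : 0 <= x -> f' x = 0.
  move=> /EE h; apply/eqP; rewrite -sqrf_eq0; apply/eqP.
  have h1 := sqr_ge0 (f x); have h2 := sqr_ge0 (f' x); nra.
move=> x x0; split; last exact: f'0.
have fc y : 0 <= y -> f y = f 0.
  rewrite le_eqVlt => /predU1P[<-//|y0]; apply/esym.
  apply: (C1_on_eq (ltW y0) (Cf y y0)) => z; rewrite in_itv/= => /andP[z0 _].
  exact/f'0/ltW.
rewrite fc//; apply/eqP/negPn/negP => f00.
apply: (@not_sqr_integrable f (f 0 ^+ 2) 0) => //.
- by rewrite exprn_even_gt0.
- by move=> y /fc ->.
Qed.
End HalfLine.

(** * Integral norms of complex-valued functions *)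
Section Norms.
Context {R : realType}.
Notation mu := (@lebesgue_measure R).
Local Notation normc := ComplexField.Normc.normc.
Implicit Types (I : set R) (u du : R -> R[i]).

Lemma normc_ge0 (z : R[i]) : 0 <= normc z.
Proof. by case: z => a b; exact: sqrtr_ge0. Qed.

Lemma normc_sqr (z : R[i]) : normc z ^+ 2 = complex.Re z ^+ 2 + complex.Im z ^+ 2.
Proof. by case: z => a b /=; rewrite sqr_sqrtr// addr_ge0 ?sqr_ge0. Qed.

Lemma normc_powR (z : R[i]) (r : R) :
  normc z `^ r = (complex.Re z ^+ 2 + complex.Im z ^+ 2) `^ (r / 2).
Proof.
rewrite -normc_sqr -powR_mulrn ?normc_ge0// -powRrM.
by congr (_ `^ _); rewrite mulrC divfK.
Qed.

(** Away from the origin the power is differentiable; at the origin it is smaller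
    than e as soon as |x| is smaller than e^(1/r). *)
Lemma powR_normr_continuous (r : R) : 0 < r -> continuous (fun x : R => `|x| `^ r).
Proof.
move=> r0 x; have [->|x0] := eqVneq x 0.
  apply/cvgrPdist_le => e e0; rewrite normr0 powR0 ?gt_eqF//.
  near=> y; rewrite sub0r normrN ger0_norm ?powR_ge0//.
  have er : e = (e `^ r^-1) `^ r by rewrite -powRrM mulVf ?gt_eqF// powRr1// ltW.
  rewrite er; apply: ge0_ler_powR; rewrite ?nnegrE ?powR_ge0 ?normr_ge0 ?(ltW r0)//.
  near: y; have e0' : 0 < e `^ r^-1 by rewrite powR_gt0.
  apply: filterS (nbhsx_ballx (0 : R) _ e0') => y.
  by rewrite /ball/= sub0r normrN => /ltW.
have cr : {for `|x|, continuous (fun y : R => y `^ r)}.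
  apply/differentiable_continuous/derivable1_diffP.
  by apply: derivable_powR; rewrite in_itv/= andbT normr_gt0.
exact: (cvg_comp _ _ (@norm_continuous _ _ x) cr).
Unshelve. all: by end_near. Qed.

Lemma within_continuous_comp I (f g : R -> R) :
  {within I, continuous f} -> continuous g -> {within I, continuous (g \o f)}.
Proof. by move=> cf cg x; exact: (cvg_comp _ _ (cf x) (cg (f x))). Qed.

(** The power of the modulus is written as a power r / 2 of the smooth function
    Re^2 + Im^2, so that no square root has to be handled. *)
Lemma continuous_onC_powR I u (r : R) : 0 < r -> continuous_onC I u ->
  {within I, continuous (fun x => normc (u x) `^ r)}.
Proof.
move=> r0 [cr ci].
have -> : (fun x => normc (u x) `^ r) = (fun x : R => `|x| `^ (r / 2)) \o
    (fun x => complex.Re (u x) ^+ 2 + complex.Im (u x) ^+ 2).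
  apply/funext => x /=; rewrite normc_powR ger0_norm// addr_ge0 ?sqr_ge0//.
apply: within_continuous_comp; last by apply: powR_normr_continuous; rewrite divr_gt0.
by move=> x; apply: cvgD; apply: cvgM; (exact: cr || exact: ci).
Qed.

Lemma measurable_normc_powR I u (r : R) :
  measurable_fun I (fun x => complex.Re (u x)) ->
  measurable_fun I (fun x => complex.Im (u x)) ->
  measurable_fun I (fun x => (normc (u x) `^ r)%:E).
Proof.
move=> mr mi; apply/measurable_EFinP.
under eq_fun do rewrite normc_powR.
apply: (measurableT_comp (measurable_powR (r / 2))).
by apply: measurable_funD; exact: measurable_funX.
Qed.

Lemma poweR_Lnorm_restr (r : R) I u : 0 < r ->
  ('N[mu]_(r%:E)[restr_norm I u] `^ r = \int[mu]_(x in I) (normc (u x) `^ r)%:E)%E.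
Proof.
move=> r0; rewrite poweR_Lnorm ?gt_eqF// [RHS]integral_mkcond.
apply: eq_integral => x _; rewrite /restr_norm !patchE; case: ifPn => _.
  by rewrite gee0_abs ?lee_fin ?normc_ge0// poweR_EFin.
by rewrite abse0 poweR0r// gt_eqF.
Qed.

(** I may be unbounded: for m = 0 the right-hand side is 0 * mu I = 0, also when
    mu I is infinite, and so a vanishing supremum norm forces a vanishing
    integral even on a half-line. *)
Lemma integral_normc_Linfty (r m : R) I u : 0 < r -> 0 <= m -> measurable I ->
  measurable_fun I (fun x => complex.Re (u x)) ->
  measurable_fun I (fun x => complex.Im (u x)) ->
  ('N[mu]_(+oo)[restr_norm I u] <= m%:E)%E ->
  (\int[mu]_(x in I) (normc (u x) `^ r)%:E <= (m `^ r)%:E * mu I)%E.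
Proof.
move=> r0 m0 mI mr mi.
have muT : mu [set: R] = +oo%E by rewrite -set_itvNyy lebesgue_measure_itv.
have muT0 : (0 < mu [set: R])%E by rewrite muT.
rewrite unlock /Lnorm (ifT _ _ muT0) => /ess_supP um.
rewrite -integral_cst//.
apply: ae_ge0_le_integral => //.
- by move=> x _; rewrite lee_fin powR_ge0.
- exact: measurable_normc_powR.
- by move=> x _; rewrite lee_fin powR_ge0.
apply: filterS um => x /= + Ix.
rewrite /restr_norm patchE mem_set// gee0_abs ?lee_fin ?normc_ge0// => h.
by rewrite ge0_ler_powR ?nnegrE ?normc_ge0// ltW.
Qed.

Lemma in_L2P I u :
  measurable_fun I (fun x => complex.Re (u x)) ->
  measurable_fun I (fun x => complex.Im (u x)) ->
  in_L2 I u <-> (\int[mu]_(x in I) (normc (u x) ^+ 2)%:E < +oo)%E.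
Proof.
move=> mr mi.
have -> : (\int[mu]_(x in I) (normc (u x) ^+ 2)%:E = 'N[mu]_(2%:E)[restr_norm I u] `^ 2)%E.
  rewrite poweR_Lnorm_restr//; apply: eq_integral => x _.
  by rewrite powR_mulrn// normc_ge0.
split; first by move=> [_ _]; exact: poweR_lty.
move=> h; split => //; rewrite ltey; apply/eqP => N; move: h.
by rewrite N poweRyr.
Qed.

Lemma integral_normc_sqr I u :
  measurable I ->
  measurable_fun I (fun x => complex.Re (u x)) ->
  measurable_fun I (fun x => complex.Im (u x)) ->
  (\int[mu]_(x in I) (normc (u x) ^+ 2)%:E =
   \int[mu]_(x in I) (complex.Re (u x) ^+ 2)%:E +
   \int[mu]_(x in I) (complex.Im (u x) ^+ 2)%:E)%E.
Proof.
move=> mI mr mi; rewrite -ge0_integralD//.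
- by apply: eq_integral => x _; rewrite normc_sqr.
- by move=> x _; rewrite lee_fin sqr_ge0.
- exact: measurable_sqr.
- by move=> x _; rewrite lee_fin sqr_ge0.
- exact: measurable_sqr.
Qed.

End Norms.

(** * Classical derivatives are weak derivatives *)
Section WeakDerivative.
Context {R : realType}.
Notation mu := (@lebesgue_measure R).
Implicit Types (I : set R) (f phi : R -> R).

Lemma test_function_C1 I phi : test_function I phi ->
  (forall x : R, is_derive x 1 phi (derive1 phi x)) /\ continuous (derive1 phi).
Proof.
move=> [dphi _]; split.
  move=> x; rewrite derive1E; apply: derivableP; exact: (dphi 0%N).
move=> x; apply/differentiable_continuous/derivable1_diffP.
by have := dphi 1%N x; rewrite derive1n1.
Qed.

Lemma derive1_vanish phi a b : (forall x, ~ `[a, b]%classic x -> phi x = 0) ->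
  forall x, ~ `[a, b]%classic x -> derive1 phi x = 0.
Proof.
move=> phi0 x xab; rewrite derive1E (@near_eq_derive _ _ _ phi (cst 0)) ?derive_cst//.
have : open (~` `[a, b]%classic) by apply: closed_openC; exact: itv_closed.
rewrite openE => /(_ x xab); apply: filterS => y; exact: phi0.
Qed.

Lemma Rintegral_restrict I (J : set R) f : J `<=` I ->
  (forall x, I x -> ~ J x -> f x = 0) ->
  \int[mu]_(x in I) f x = \int[mu]_(x in J) f x.
Proof.
move=> JI f0; rewrite Rintegral_mkcond [RHS]Rintegral_mkcond.
congr Rintegral; apply/funext => x; rewrite !patchE.
case: ifPn => [|nI]; last by rewrite ifF//; apply: contraNF nI; rewrite !inE; exact: JI.
rewrite inE => Ix; case: ifPn => //; rewrite notin_setE; exact: f0.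
Qed.

(** The boundary terms of the product f phi vanish. *)
Lemma C1_on_parts T f f' phi phi' : 0 < T -> C1_on 0 T f f' -> C1_on 0 T phi phi' ->
  phi 0 = 0 -> phi T = 0 ->
  \int[mu]_(x in `[0, T]) (f x * phi' x) = - \int[mu]_(x in `[0, T]) (f' x * phi x).
Proof.
move=> T0 Cf Cphi phi0 phiT; apply/eqP; rewrite -addr_eq0.
have int g : {within `[0, T], continuous g} -> mu.-integrable `[0, T] (EFin \o g).
  by move=> cg; apply: continuous_compact_integrable => //; exact: segment_compact.
have [cf cf' _] := Cf; have [cp cp' _] := Cphi.
rewrite -RintegralD//; first last.
- by apply: int => x; apply: cvgM; [exact: cf'|exact: cp].
- by apply: int => x; apply: cvgM; [exact: cf|exact: cp'].
by rewrite /Rintegral (C1_on_FTC T0 (C1_onM Cf Cphi))/= phi0 phiT !mulr0 subrr.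
Qed.

Lemma weak_derivR_segment l f f' : 0 < l -> C1_on 0 l f f' ->
  weak_derivR `[0, l] f f'.
Proof.
move=> l0 Cf phi tphi; have [dphi cphi] := test_function_C1 tphi.
have [_ [a [b [ab phi0]]]] := tphi.
apply: C1_on_parts => //; first exact: C1_on_global.
- by apply: phi0 => /ab; rewrite interior_itv/= in_itv/= ltxx.
- by apply: phi0 => /ab; rewrite interior_itv/= in_itv/= ltxx andbF.
Qed.

Lemma weak_derivR_halfline f f' : (forall T : R, 0 < T -> C1_on 0 T f f') ->
  weak_derivR `[0, +oo[ f f'.
Proof.
move=> Cf phi tphi; have [dphi cphi] := test_function_C1 tphi.
have [_ [a [b [ab phi0]]]] := tphi.
have dphi0 := derive1_vanish phi0.
(* the support of phi lies in [a, b], so everything happens on [0, T] *)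
pose T := Num.max b 0 + 1.
have T0 : 0 < T by rewrite ltr_wpDl// le_max lexx orbT.
have bT : b < T by rewrite ltr_pwDr// le_max lexx.
have sub : `[0, T]%classic `<=` (`[0, +oo[%classic : set R).
  by move=> x /=; rewrite !in_itv/= andbT => /andP[].
have out x : `[0, +oo[%classic x -> ~ `[0, T]%classic x -> ~ `[a, b]%classic x.
  rewrite /= !in_itv/= andbT => -> /= /negP; rewrite -ltNge => Tx /andP[_ xb].
  by have := lt_trans bT (lt_le_trans Tx xb); rewrite ltxx.
rewrite (Rintegral_restrict sub) => [|x Ix Jx]; last first.
  by rewrite dphi0 ?mulr0//; exact: out.
rewrite [in RHS](Rintegral_restrict sub) => [|x Ix Jx]; last first.
  by rewrite phi0 ?mulr0//; exact: out.
apply: C1_on_parts => //; [exact: Cf|exact: C1_on_global| |].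
- by apply: phi0 => /ab; rewrite interior_itv/= in_itv/= ltxx.
- by apply: phi0 => /=; rewrite in_itv/= (leNgt T) bT andbF.
Qed.
End WeakDerivative.

(** * The equation on a single edge *)
Section Edge.
Context {R : realType}.
Notation mu := (@lebesgue_measure R).
Local Notation normc := ComplexField.Normc.normc.
Local Notation Re := (@complex.Re R).
Local Notation Im := (@complex.Im R).
Implicit Types (u du ddu : R -> R[i]).

Lemma NLS_ReIm (z w : R[i]) (k lam : R) : w + k%:C%C * z = lam%:C%C * z ->
  Re w = (lam - k) * Re z /\ Im w = (lam - k) * Im z.
Proof.
case: z w => [a b] [c d]; rewrite /=; simpc => -[h1 h2].
by split => /=; lra.
Qed.

Lemma segment_bounded (l : R) (q : R -> R) : 0 <= l -> {within `[0, l], continuous q} ->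
  exists M, forall x, x \in `[0, l] -> `|q x| <= M.
Proof.
move=> l0 cq.
have cq' : {within `[0, l], continuous (fun x => `|q x|)}.
  by move=> x; apply: (cvg_comp _ _ (cq x)); exact: norm_continuous.
have [c _ cM] := EVT_max l0 cq'; by exists `|q c|.
Qed.

(** Solutions of u'' = q u in first-order form, componentwise. The nonlinear
    equation is of this form with q = lam - kappa |u|^(p-2), a function of x
    through the solution itself; for uniqueness it is enough that q is
    continuous. *)
Definition sol_on (q : R -> R) (l : R) u du : Prop :=
  [/\ C1_on 0 l (Re \o u) (Re \o du), C1_on 0 l (Im \o u) (Im \o du),
      C1_on 0 l (Re \o du) (fun x => q x * Re (u x)) &
      C1_on 0 l (Im \o du) (fun x => q x * Im (u x))].

(** The interval [0, l] sits in the edge I: it is the whole of a bounded edge, or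
    an initial piece of a half-line. Continuity of u bounds u'' = q u, and this
    is what [C1_on_has_deriv] needs. *)
Lemma NLS_sol_on (I : set R) (l p lam k : R) u du ddu : 0 < l -> 2 < p ->
  `[0, l]%classic `<=` I ->
  (forall x, x \in `]0, l[ -> interior I x) ->
  (forall x, I x -> has_derivC I u x (du x)) ->
  (forall x, interior I x -> has_derivC I du x (ddu x)) ->
  (forall x, interior I x ->
     ddu x + (k * normc (u x) `^ (p - 2))%:C%C * u x = lam%:C%C * u x) ->
  sol_on (fun x => lam - k * normc (u x) `^ (p - 2)) l u du /\
  {within `[0, l], continuous (fun x => lam - k * normc (u x) `^ (p - 2))}.
Proof.
move=> l0 p2 lI intI du_u ddu_du nls.
have cu : continuous_onC `[0, l] u.
  split.
  - apply: (@has_derivR_continuous _ _ _ (Re \o du)) => x xl.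
    by apply: (has_derivR_sub lI); have [] := du_u x (lI x xl).
  - apply: (@has_derivR_continuous _ _ _ (Im \o du)) => x xl.
    by apply: (has_derivR_sub lI); have [] := du_u x (lI x xl).
have cq : {within `[0, l], continuous (fun x => lam - k * normc (u x) `^ (p - 2))}.
  move=> x; apply: cvgB; first exact: cvg_cst.
  apply: cvgM; first exact: cvg_cst.
  by apply: continuous_onC_powR => //; rewrite subr_gt0.
split => //.
set q : R -> R := fun x => lam - k * normc (u x) `^ (p - 2) in cq *.
have [M qM] := segment_bounded (ltW l0) cq.
have main (c : R[i] -> R) : {within `[0, l], continuous (c \o u)} ->
   (forall x, I x -> has_derivR I (c \o u) x (c (du x))) ->
   (forall x, interior I x -> has_derivR I (c \o du) x (c (ddu x))) ->
   (forall x, interior I x -> c (ddu x) = q x * c (u x)) ->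
   C1_on 0 l (c \o u) (c \o du) /\ C1_on 0 l (c \o du) (fun x => q x * c (u x)).
  move=> ccu cdu cddu ceq.
  have [N uN] := segment_bounded (ltW l0) ccu.
  have d2 x : x \in `]0, l[ -> is_derive x 1 (c \o du) (q x * c (u x)).
    move=> xl; have Ix := intI x xl.
    by apply: (has_derivR_is_derive Ix); rewrite -ceq//; exact: cddu.
  have C1 : C1_on 0 l (c \o u) (c \o du).
    apply: (C1_on_has_deriv (g := fun x => q x * c (u x)) (M := M * N)) => //.
      by move=> x xl; apply: (has_derivR_sub lI); apply: cdu; exact: lI.
    move=> x xl; have xl' := subset_itv_oo_cc xl.
    by rewrite normrM ler_pM//; [exact: qM|exact: uN].
  split => //; have [_ c1 _] := C1; split => //.
  by move=> x; apply: cvgM; [exact: cq|exact: ccu].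
have [cr ci] := cu.
have [r1 r2] : C1_on 0 l (Re \o u) (Re \o du) /\
    C1_on 0 l (Re \o du) (fun x => q x * Re (u x)).
  apply: main => // x Ix; [by have [] := du_u x Ix|by have [] := ddu_du x Ix|].
  by have [] := NLS_ReIm (nls x Ix).
have [i1 i2] : C1_on 0 l (Im \o u) (Im \o du) /\
    C1_on 0 l (Im \o du) (fun x => q x * Im (u x)).
  apply: main => // x Ix; [by have [] := du_u x Ix|by have [] := ddu_du x Ix|].
  by have [] := NLS_ReIm (nls x Ix).
by [].
Qed.

Lemma sol_on_unique q l u du : 0 < l -> sol_on q l u du ->
  {within `[0, l], continuous q} ->
  (u 0 = 0 /\ du 0 = 0) \/ (u l = 0 /\ du l = 0) ->
  forall x, x \in `[0, l] -> u x = 0 /\ du x = 0.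
Proof.
move=> l0 [r1 i1 r2 i2] cq init x xl.
have [M qM] := segment_bounded (ltW l0) cq.
have qM' y : y \in `]0, l[ -> `|q y| <= M by move=> /subset_itv_oo_cc; exact: qM.
have [|ru rdu] := linear_ODE_unique l0 r1 r2 qM' _ xl.
  by case: init => -[/= -> ->]; [left|right].
have [|iu idu] := linear_ODE_unique l0 i1 i2 qM' _ xl.
  by case: init => -[/= -> ->]; [left|right].
move: ru rdu iu idu => /=.
by case: (u x) (du x) => [a b] [c d] /= -> -> -> ->.
Qed.

(** The real scalar product of the plane, Re (conj z * t). *)
Definition dotC (z t : R[i]) : R := Re z * Re t + Im z * Im t.

(** Half of the derivative of |u|^2: the boundary term that arises when the
    equation is multiplied by the conjugate of u and integrated. *)
Definition flux u du (x : R) := dotC (u x) (du x).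

(** The derivative of the flux is |u'|^2 + lam |u|^2 - |u|^p; the term in lam
    has a sign and is dropped. *)
Lemma segment_energy (l p lam : R) u du : 0 < l -> 2 < p -> 0 <= lam ->
  sol_on (fun x => lam - 1 * normc (u x) `^ (p - 2)) l u du ->
  (\int[mu]_(x in `[0%R, l]) (normc (du x) ^+ 2)%:E <=
     (flux u du l - flux u du 0)%:E +
     \int[mu]_(x in `[0%R, l]) (normc (u x) `^ p)%:E)%E.
Proof.
move=> l0 p2 lam0 [r1 i1 r2 i2].
have CW := C1_onD (C1_onM r1 r2) (C1_onM i1 i2).
have [_ cW' _] := CW.
have [cr crd _] := r1; have [ci cid _] := i1.
have cup : {within `[0, l], continuous (fun x => normc (u x) `^ p)}.
  by apply: continuous_onC_powR => //; exact: lt_trans p2.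
have cdu : {within `[0, l], continuous (fun x => normc (du x) ^+ 2)}.
  have -> : (fun x => normc (du x) ^+ 2) = (fun x => Re (du x) ^+ 2 + Im (du x) ^+ 2).
    by apply/funext => x; rewrite normc_sqr.
  by move=> x; apply: cvgD; apply: cvgM; (exact: crd || exact: cid).
have int g : {within `[0, l], continuous g} -> mu.-integrable `[0, l] (EFin \o g).
  by move=> cg; apply: continuous_compact_integrable => //; exact: segment_compact.
rewrite /flux /dotC -(C1_on_FTC l0 CW) -integralD//; [|exact: int cW'|exact: int cup].
apply: le_integral => //; first exact: int cdu.
  by apply: integrableD => //; [exact: int cW'|exact: int cup].
move=> x _; rewrite -EFinD lee_fin /=.
have -> : normc (u x) `^ p = normc (u x) `^ (p - 2) * (Re (u x) ^+ 2 + Im (u x) ^+ 2).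
  rewrite -normc_sqr -powR_mulrn ?normc_ge0// -powRD ?subrK//.
  by apply/implyP => /eqP p0; exfalso; move: p2; rewrite p0 ltrn0.
rewrite normc_sqr -subr_ge0.
set w := _ `^ _.
rewrite (_ : _ - _ = lam * (Re (u x) ^+ 2 + Im (u x) ^+ 2)); last by ring.
by rewrite mulr_ge0// addr_ge0 ?sqr_ge0.
Qed.

End Edge.

(** * Walks without reversals and cycles *)
Section Walks.
Local Open Scope nat_scope.
Context {V E : finType} (src tgt : E -> V).
Implicit Types (d : E * bool) (s : seq (E * bool)).

Definition dart_rev d : E * bool := (d.1, ~~ d.2).

Lemma dart_src_rev d : dart_src src tgt (dart_rev d) = dart_tgt src tgt d.
Proof. by case: d => e []. Qed.

Lemma dart_tgt_rev d : dart_tgt src tgt (dart_rev d) = dart_src src tgt d.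
Proof. by case: d => e []. Qed.

Lemma same_edge_darts d d' : d.1 = d'.1 -> d' = d \/ d' = dart_rev d.
Proof. by case: d d' => e [] [e' []] /= ->; [left|right|right|left]. Qed.

Definition nonbacktracking : rel (E * bool) :=
  fun d d' => (dart_tgt src tgt d == dart_src src tgt d') && (d' != dart_rev d).

(** If the edge of the first dart x occurs again, it occurs reversed, as the
    sources are distinct. The reversed dart starts where x ends, which is also
    where the second dart starts; so it is the second dart, and the walk would
    turn back. *)
Lemma nonbacktracking_uniq_edges s : sorted nonbacktracking s ->
  uniq [seq dart_src src tgt d | d <- s] -> uniq [seq d.1 | d <- s].
Proof.
elim: s => //= x s IHs xs /andP[xNs us].
rewrite IHs ?(path_sorted xs)// andbT; apply/mapP => -[d ds xd].
have [dx|dx] := same_edge_darts xd.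
  by move/mapP: xNs; apply; exists d => //; rewrite dx.
case: s xs us ds {IHs xNs} => //= y s /andP[/andP[/eqP xy yx] _] /andP[yNs _].
rewrite inE => /predU1P[dy|ds]; first by rewrite -dy dx eqxx in yx.
by move/mapP: yNs; apply; exists d => //; rewrite dx dart_src_rev.
Qed.

(** A walk can be prolonged unless it returns to its starting point, and it
    cannot go on forever without repeating a vertex. At the first repetition the
    part of the walk between the two visits is a cycle. *)
Lemma nonbacktracking_walk_cycle (S : pred E) d0 : S d0.1 ->
  (forall d, S d.1 -> dart_tgt src tgt d != dart_src src tgt d0 ->
     exists2 d', S d'.1 & nonbacktracking d d') ->
  exists s, is_graph_cycle src tgt s.
Proof.
move=> Sd0 step.
suff grow n s : path nonbacktracking d0 s -> all (fun d => S d.1) (d0 :: s) ->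
    uniq [seq dart_src src tgt d | d <- d0 :: s] -> #|V| - size s <= n ->
    exists s, is_graph_cycle src tgt s.
  by apply: (grow #|V| [::]) => //=; rewrite ?Sd0// subn0.
(* n bounds the number of vertices that are still to be visited *)
elim: n s => [|n IHn] s ps Ss us ns.
  have := max_card [in [seq dart_src src tgt d | d <- d0 :: s]].
  rewrite (card_uniqP us) size_map /= ltnNge.
  by move: ns; rewrite leqn0 subn_eq0 => ->.
set d := last d0 s.
have [inV|ninV] := boolP (dart_tgt src tgt d \in [seq dart_src src tgt d | d <- d0 :: s]).
  have [x xs dx] := mapP inV.
  have [t1 [t2 tE]] : exists t1 t2, d0 :: s = t1 ++ x :: t2.
    by case/splitPr: xs => t1 t2; exists t1, t2.
  have dE : d = last x t2 by rewrite /d -(last_cons d0 d0) tE last_cat.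
  have st : sorted nonbacktracking (x :: t2).
    by have : sorted nonbacktracking (d0 :: s); rewrite // tE => /cat_sorted2[].
  have ut : uniq [seq dart_src src tgt d | d <- x :: t2].
    by move: us; rewrite tE map_cat cat_uniq => /and3P[].
  exists (x :: t2); rewrite /is_graph_cycle ut nonbacktracking_uniq_edges//= andbT.
  rewrite rcons_path -dE dx eqxx andbT.
  by apply: sub_path st => y z /andP[].
have [d' Sd' dd'] : exists2 d', S d'.1 & nonbacktracking d d'.
  apply: step.
    by move/allP: Ss; apply; exact: mem_last.
  by apply: contraNneq ninV => ->; rewrite inE eqxx.
have /andP[/eqP td' _] := dd'.
apply: (IHn (rcons s d')).
- by rewrite rcons_path ps.
- by rewrite -rcons_cons all_rcons Sd' Ss.
- by rewrite -rcons_cons map_rcons rcons_uniq -td' ninV.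
- by rewrite size_rcons; lia.
Qed.
End Walks.

(** * Degrees and pendants of a metric graph *)
Section Combinatorics.
Local Open Scope nat_scope.
Context {R : realType} (G : metric_graph R).
Local Notation dsrc := (dart_src (@bsrc R G) (@btgt R G)).
Local Notation dtgt := (dart_tgt (@bsrc R G) (@btgt R G)).
Local Notation dart := (bedge G * bool)%type.

(** A sum over the edge ends at v, a self-loop counting twice, is a sum over the
    darts that start at v. *)
Lemma sum_darts (M : nmodType) (F : dart -> M) (v : vertex G) :
  (\sum_(d | dsrc d == v) F d =
   \sum_(b | bsrc b == v) F (b, true) + \sum_(b | btgt b == v) F (b, false))%R.
Proof.
rewrite !(big_mkcond (fun b => _ == v)) -big_split/= big_mkcond.
transitivity (\sum_b \sum_c (if dsrc (b, c) == v then F (b, c) else 0))%R.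
  by rewrite pair_bigA; apply: eq_bigr => -[].
by apply: eq_bigr => b _; rewrite big_bool.
Qed.

Lemma degree_darts (v : vertex G) :
  degree v = #|[set d | dsrc d == v]%SET| + #|[set h : hline G | hroot h == v]%SET|.
Proof.
by rewrite /degree -!sum1dep_card (sum_darts (fun=> 1) v).
Qed.

Lemma degree1_dart v d : degree v = 1 -> dsrc d = v ->
  (forall d', dsrc d' = v -> d' = d) /\ (forall h : hline G, hroot h != v).
Proof.
rewrite degree_darts => deg dv; split.
  move=> d' d'v; apply/eqP/negPn/negP => d'd.
  suff : [set d'; d]%SET \subset [set d | dsrc d == v]%SET.
    by move/subset_leq_card; rewrite cards2 d'd; lia.
  by apply/fintype.subsetP => x; rewrite !inE => /orP[]/eqP->; apply/eqP.
move=> h; apply/negP => /eqP hv.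
have : 0 < #|[set d | dsrc d == v]%SET| by apply/card_gt0P; exists d; rewrite inE dv.
have : 0 < #|[set h : hline G | hroot h == v]%SET|.
  by apply/card_gt0P; exists h; rewrite inE hv.
lia.
Qed.

(** The two ends of e form a connected component, so all the half-lines of the
    graph would have to be attached at them. *)
Lemma isolated_edge_compact (e : bedge G) : degree (bsrc e) = 1 -> degree (btgt e) = 1 ->
  ~ noncompact G.
Proof.
move=> d1 d2 /card_gt0P[h _].
have [u1 h1] := degree1_dart (d := (e, true)) d1 erefl.
have [u2 h2] := degree1_dart (d := (e, false)) d2 erefl.
suff : (hroot h == bsrc e) || (hroot h == btgt e).
  by rewrite (negbTE (h1 h)) (negbTE (h2 h)).
have /connectP[q qp ->] := mg_connected (bsrc e) (hroot h).
have cl x : path (Defs.adjacent (@bsrc R G) (@btgt R G)) x q ->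
    (x == bsrc e) || (x == btgt e) -> (last x q == bsrc e) || (last x q == btgt e).
  elim: q x {qp} => //= v q IHq x /andP[/existsP[d]].
  move=> /andP[/eqP dx /eqP dv] qp xe; apply: (IHq v qp).
  have [|] := orP xe => /eqP ex; rewrite ex in dx.
    by rewrite -dv (u1 _ dx) eqxx orbT.
  by rewrite -dv (u2 _ dx) eqxx.
by apply: cl => //; rewrite eqxx.
Qed.

Lemma in_coreT (v : vertex G) : nonempty_core G -> in_core v.
Proof.
move=> /card_gt0P[e _].
have /connectP[[/= _ <-|w q /= /andP[/existsP[[b c]]]]] := mg_connected v (bsrc e).
  by exists e; left.
by move=> /andP[/eqP <- _] _ _; exists b; case: c; [left|right].
Qed.

End Combinatorics.

(** * Incompatibility of the a priori bounds *)
Section Arithmetic.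
Context {R : realType}.
Implicit Types p m d k : R.

(** In logarithms all the relations are linear. The bound on ln d from the
    L^p inequality is multiplied by p - 4 >= 0 and the one from the supremum
    norm by 6 - p > 0; their sum eliminates ln d and is a positive multiple of
    the claim, thanks to p (6 - p) + (p - 4) (p + 2) = 4 (p - 2). *)
Lemma GN_incompatible p m Cp Ci L d k : 4 <= p -> p < 6 -> 0 < m -> 0 < Cp -> 0 < Ci ->
  0 < L -> 0 < d -> d <= k ->
  k <= Cp * (m `^ 2^-1) `^ (p / 2 + 1) * (d `^ 2^-1) `^ (p / 2 - 1) ->
  k <= L * (Ci * (m `^ 2^-1) `^ 2^-1 * (d `^ 2^-1) `^ 2^-1) `^ p ->
  Ci `^ (- p) * Cp `^ ((4 - p) / (6 - p)) <= m `^ ((p - 2) / (6 - p)) * L.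
Proof.
move=> p4 p6 m0 Cp0 Ci0 L0 d0 dk k1 k2.
have := le_trans dk k1; have := le_trans dk k2 => {dk k1 k2}.
set A := L * _; set B := Cp * _ * _; move=> dA dB.
have : ln d <= ln A by rewrite ler_ln ?posrE// ?(lt_le_trans d0 dA).
have : ln d <= ln B by rewrite ler_ln ?posrE// ?(lt_le_trans d0 dB).
suff : ln A >= ln d -> ln B >= ln d ->
    ln (Ci `^ (- p) * Cp `^ ((4 - p) / (6 - p))) <= ln (m `^ ((p - 2) / (6 - p)) * L).
  move=> suf h2 h1; have := suf h1 h2.
  by rewrite ler_ln ?posrE ?mulr_gt0 ?powR_gt0.
rewrite /A /B {dA dB}.
rewrite !(lnM, ln_powR) ?posrE ?mulr_gt0 ?powR_gt0 ?mulr_gt0 ?powR_gt0//.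
set c := ln Cp; set i := ln Ci; set l := ln L; set e := ln d; set n := ln m.
move=> h2 h1.
have s0 : 0 < 6 - p by lra.
rewrite -(ler_pM2l s0) !mulrDr.
have -> : (6 - p) * ((4 - p) / (6 - p) * c) = (4 - p) * c.
  by rewrite mulrA (mulrC (6 - p)) divfK// gt_eqF.
have -> : (6 - p) * ((p - 2) / (6 - p) * n) = (p - 2) * n.
  by rewrite mulrA (mulrC (6 - p)) divfK// gt_eqF.
have g1 : (6 - p) * e <= 4 * c + (p + 2) * n by lra.
have g2 : 0 <= 4 * l + 4 * (p * i) + p * n + (p - 4) * e by lra.
have p40 : 0 <= p - 4 by lra.
have := ler_wpM2l p40 g1; have := mulr_ge0 (ltW s0) g2.
rewrite !mulrDr; lra.
Qed.
End Arithmetic.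

(** * Norms on a metric graph *)
Section GraphNorms.
Context {R : realType} (G : metric_graph R).
Notation mu := (@lebesgue_measure R).
Local Notation normc := ComplexField.Normc.normc.
Implicit Types (u du : gfun G).

Lemma measurable_edge_itv (e : edge G) : measurable (edge_itv e).
Proof. by case: e => ?; exact: measurable_itv. Qed.

Lemma Lp_graph_powR (r : R) u : 0 < r ->
  (Lp_graph r u `^ r = \sum_(e : edge G) \int[mu]_(x in edge_itv e) (normc (u e x) `^ r)%:E)%E.
Proof.
move=> r0; rewrite /Lp_graph -poweRrM mulVf ?gt_eqF// poweRe1.
  by apply: eq_bigr => e _; rewrite poweR_Lnorm_restr.
by apply: sume_ge0 => e _; exact: poweR_ge0.
Qed.

Lemma Lp_graph2 u : (Lp_graph 2 u =
  (\sum_(e : edge G) \int[mu]_(x in edge_itv e) (normc (u e x) ^+ 2)%:E) `^ 2^-1)%E.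
Proof.
rewrite /Lp_graph; congr (_ `^ _)%E; apply: eq_bigr => e _.
rewrite poweR_Lnorm_restr//; apply: eq_integral => x _.
by rewrite powR_mulrn ?normc_ge0.
Qed.

Lemma sqr_Lp_graph2 u : (Lp_graph 2 u ^+ 2 =
  \sum_(e : edge G) \int[mu]_(x in edge_itv e) (normc (u e x) ^+ 2)%:E)%E.
Proof.
rewrite Lp_graph2; set S := (\sum_e _)%E.
have S0 : (0 <= S)%E.
  by apply: sume_ge0 => e _; apply: integral_ge0 => x _; rewrite lee_fin sqr_ge0.
have h1 : 2^-1 + 2^-1 = 1 :> R by rewrite [RHS]splitr mul1r.
by rewrite expe2 -poweRD ?h1 ?poweRe1// /poweRD_def h1 oner_eq0.
Qed.

End GraphNorms.

(** * Nonpositive multipliers *)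
Section BoundState.
Context {R : realType} (G : metric_graph R).
Notation mu := (@lebesgue_measure R).
Local Notation normc := ComplexField.Normc.normc.
Local Notation Re := (@complex.Re R).
Local Notation Im := (@complex.Im R).
Local Notation dsrc := (dart_src (@bsrc R G) (@btgt R G)).
Local Notation dtgt := (dart_tgt (@bsrc R G) (@btgt R G)).
Local Notation follows := (nonbacktracking (@bsrc R G) (@btgt R G)).
Implicit Types (u du ddu : gfun G) (p lam : R).

(** The differential part of the definition of a bound state, without the mass
    and the Kirchhoff conditions. *)
Definition NLS_solution p lam u du ddu : Prop :=
  [/\ forall e x, edge_itv e x -> has_derivC (edge_itv e) (u e) x (du e x),
      forall e x, interior (edge_itv e) x -> has_derivC (edge_itv e) (du e) x (ddu e x) &
      forall e, NLS_on_edge p lam u ddu e].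

Lemma NLS_solution_segment p lam u du ddu b : 2 < p -> NLS_solution p lam u du ddu ->
  sol_on (fun x => lam - 1 * normc (u (inl b) x) `^ (p - 2)) (len b)
    (u (inl b)) (du (inl b)) /\
  {within `[0, len b], continuous (fun x => lam - 1 * normc (u (inl b) x) `^ (p - 2))}.
Proof.
move=> p2 [d1 d2 nls]; have l0 := len_gt0 b.
apply: (@NLS_sol_on R (edge_itv (inl b)) _ _ _ _ _ _ (ddu (inl b))) => //.
- by move=> x xl; rewrite /edge_itv interior_itv.
- exact: d1.
- exact: d2.
- by move=> x Ix; rewrite -(nls (inl b) x Ix).
Qed.

(** On a half-line the equation is linear, so the two components solve it
    separately. *)
Lemma NLS_solution_hline p lam u du ddu h : 2 < p -> NLS_solution p lam u du ddu ->
  halfline_sol lam (Re \o u (inr h)) (Re \o du (inr h)) /\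
  halfline_sol lam (Im \o u (inr h)) (Im \o du (inr h)).
Proof.
move=> p2 [d1 d2 nls].
suff key T : 0 < T -> sol_on (fun=> lam) T (u (inr h)) (du (inr h)).
  by split => T /key [].
move=> T0.
have -> : (fun=> lam) = (fun x => lam - 0 * normc (u (inr h) x) `^ (p - 2)).
  by apply/funext => x; rewrite mul0r subr0.
apply: (@NLS_sol_on R (edge_itv (inr h)) _ _ _ _ _ _ (ddu (inr h)) _ _ _ _ _ _ _).1 => //.
- by move=> x /=; rewrite !in_itv/= andbT => /andP[].
- by move=> x xl; rewrite /edge_itv interior_itv/= in_itv/= andbT (itvP xl).
- exact: d1.
- exact: d2.
- by move=> x Ix; rewrite -(nls (inr h) x Ix).
Qed.

Lemma in_H1_in_L2 u e : in_H1 u -> in_L2 (edge_itv e) (u e).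
Proof. by move=> [v [_ /(_ e)[]]]. Qed.

Lemma in_L2_sqr_integrable (e : edge G) (v : R -> R[i]) : in_L2 (edge_itv e) v ->
  (\int[mu]_(x in edge_itv e) (Re (v x) ^+ 2)%:E < +oo)%E /\
  (\int[mu]_(x in edge_itv e) (Im (v x) ^+ 2)%:E < +oo)%E.
Proof.
move=> L2; have [mr mi _] := L2.
have /(in_L2P mr mi) : in_L2 (edge_itv e) v by [].
rewrite integral_normc_sqr//; last exact: measurable_edge_itv.
have r0 : (0 <= \int[mu]_(x in edge_itv e) (Re (v x) ^+ 2)%:E)%E.
  by apply: integral_ge0 => x _; rewrite lee_fin sqr_ge0.
have i0 : (0 <= \int[mu]_(x in edge_itv e) (Im (v x) ^+ 2)%:E)%E.
  by apply: integral_ge0 => x _; rewrite lee_fin sqr_ge0.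
by move=> h; split; apply: le_lt_trans h; rewrite ?leeDl ?leeDr.
Qed.

Lemma hline_vanish p lam u du ddu h : 2 < p -> lam <= 0 -> in_H1 u ->
  NLS_solution p lam u du ddu ->
  forall x, 0 <= x -> u (inr h) x = 0 /\ du (inr h) x = 0.
Proof.
move=> p2 lam0 uH sol x x0.
have [sr si] := NLS_solution_hline h p2 sol.
have [ir ii] := in_L2_sqr_integrable (in_H1_in_L2 (inr h) uH).
have [/= r1 r2] := halfline_vanish lam0 sr ir x0.
have [/= i1 i2] := halfline_vanish lam0 si ii x0.
by move: r1 r2 i1 i2; case: (u _ x) (du _ x) => [a b] [c d] /= -> -> -> ->.
Qed.

Definition outgoing_deriv du (d : bedge G * bool) : R[i] :=
  if d.2 then du (inl d.1) 0 else - du (inl d.1) (len d.1).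

Lemma kirchhoff_sum_darts du v : kirchhoff_sum du v =
  \sum_(d | dsrc d == v) outgoing_deriv du d + \sum_(h : hline G | hroot h == v) du (inr h) 0.
Proof. by rewrite /kirchhoff_sum sum_darts. Qed.

(** The derivative is included so that the contribution of the edge to the
    Kirchhoff sums at its ends is seen to be zero. *)
Definition edge_vanishes u du (b : bedge G) : bool :=
  `[< forall x, x \in `[0, len b] -> u (inl b) x = 0 /\ du (inl b) x = 0 >].

Lemma edge_vanishes_dart u du (w : vertex G -> R[i]) d :
  (forall b : bedge G, u (inl b) 0 = w (bsrc b)) ->
  (forall b : bedge G, u (inl b) (len b) = w (btgt b)) ->
  edge_vanishes u du d.1 -> w (dsrc d) = 0 /\ outgoing_deriv du d = 0.
Proof.
move=> w0 wl /asboolP h; case: d h => b [] /= h.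
  have [|u0 du0] := h 0; first by rewrite in_itv/= lexx ltW ?len_gt0.
  by rewrite /outgoing_deriv/= /dart_src/= -w0 u0 du0.
have [|u0 du0] := h (len b); first by rewrite in_itv/= lexx ltW ?len_gt0.
by rewrite /outgoing_deriv/= /dart_src/= -wl u0 du0 oppr0.
Qed.

Lemma dart_edge_vanishes p lam u du ddu (w : vertex G -> R[i]) d : 2 < p ->
  NLS_solution p lam u du ddu ->
  (forall b : bedge G, u (inl b) 0 = w (bsrc b)) ->
  (forall b : bedge G, u (inl b) (len b) = w (btgt b)) ->
  w (dsrc d) = 0 -> outgoing_deriv du d = 0 -> edge_vanishes u du d.1.
Proof.
move=> p2 sol w0 wl wd od; apply/asboolP.
have [s1 s2] := NLS_solution_segment d.1 p2 sol.
apply: (sol_on_unique (len_gt0 d.1) s1 s2).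
case: d wd od {s1 s2} => b [] /=; rewrite /outgoing_deriv/= /dart_src/= => wd od.
  by left; rewrite w0.
by right; rewrite wl wd; split => //; apply/eqP; rewrite -oppr_eq0 od.
Qed.

(** Let v be the end of d and suppose that u vanishes on all the other darts at
    v. If any other edge or half-line is attached at v, then u is zero at v by
    continuity, the Kirchhoff condition leaves only the derivative along d,
    which is therefore zero too, and u vanishes on d by uniqueness. *)
Lemma stuck_degree1 p lam u du ddu (w : vertex G -> R[i]) d : 2 < p -> lam <= 0 ->
  in_H1 u -> NLS_solution p lam u du ddu ->
  (forall v, in_core v -> kirchhoff_sum du v = 0) ->
  (forall b : bedge G, u (inl b) 0 = w (bsrc b)) ->
  (forall b : bedge G, u (inl b) (len b) = w (btgt b)) ->
  (forall h : hline G, u (inr h) 0 = w (hroot h)) ->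
  ~~ edge_vanishes u du d.1 ->
  (forall d', ~~ edge_vanishes u du d'.1 ->
     ~~ follows d d') ->
  degree (dtgt d) = 1%N.
Proof.
move=> p2 lam0 uH sol kir w0 wl wh dS stuck.
set v := dtgt d; set r := dart_rev d.
have rv : dsrc r = v by exact: dart_src_rev.
have others d' : dsrc d' = v -> d' != r -> edge_vanishes u du d'.1.
  move=> d'v d'r; apply/negPn/negP => /stuck.
  by rewrite /nonbacktracking d'v eqxx d'r.
have hv h : hroot h = v -> w v = 0.
  by move=> <-; rewrite -wh; have [] := hline_vanish h p2 lam0 uH sol (lexx 0).
have wv : w v != 0.
  apply/negP => /eqP wv0; move/negP: dS; apply.
  rewrite -[d.1]/(r.1); apply: (dart_edge_vanishes p2 sol w0 wl); first by rewrite rv.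
  have := kir v; rewrite kirchhoff_sum_darts (bigD1 r) ?rv//= !big1 ?addr0; first last.
  - move=> d' /andP[/eqP d'v d'r].
    by have [] := edge_vanishes_dart w0 wl (others d' d'v d'r).
  - by move=> h _; have [] := hline_vanish h p2 lam0 uH sol (lexx 0).
  apply; exists d.1; rewrite /v; case: (d) => b []; [by right|by left].
rewrite degree_darts.
have -> : [set h : hline G | hroot h == v]%SET = finset.set0.
  apply/finset.setP => h; rewrite !inE; apply/negP => /eqP /hv /eqP.
  by rewrite (negbTE wv).
have -> : [set d | dsrc d == v]%SET = [set r]%SET.
  apply/finset.setP => d'; rewrite !inE; apply/eqP/eqP => [d'v|->//].
  apply/eqP/negPn/negP => /(others d' d'v) /(edge_vanishes_dart w0 wl)[].
  by rewrite d'v => /eqP; rewrite (negbTE wv).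
by rewrite cards0 cards1.
Qed.

(** If there is a dead end, the walk starts there: it belongs to the only
    pendant, so a second dead end would be the other end of the same edge, and
    the graph would be compact by [isolated_edge_compact]. *)
Lemma nonpositive_multiplier_vanish p lam u du ddu b : 2 < p -> lam <= 0 ->
  noncompact G -> is_tree G -> (#|pendants G| <= 1)%N ->
  in_H1 u -> NLS_solution p lam u du ddu ->
  (forall v, in_core v -> kirchhoff_sum du v = 0) ->
  edge_vanishes u du b.
Proof.
move=> p2 lam0 nc tree pend uH sol kir.
have [_ [[_ [w [w0 wl wh]]] _]] := uH.
apply/negPn/negP => bS.
pose S e := ~~ edge_vanishes u du e.
have deg1 d : S d.1 -> (forall d', S d'.1 ->
     ~~ follows d d') -> degree (dtgt d) = 1%N.
  exact: (stuck_degree1 p2 lam0 uH sol kir w0 wl wh).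
have pdt d : degree (dtgt d) = 1%N -> d.1 \in pendants G.
  by rewrite inE /pendant /dart_tgt; case: d.2 => ->; rewrite ?eqxx ?orbT.
suff [d0 Sd0 step] : exists2 d0, S d0.1 & forall d, S d.1 -> dtgt d != dsrc d0 ->
     exists2 d', S d'.1 & follows d d'.
  have [s] := nonbacktracking_walk_cycle Sd0 step.
  by apply/negP; exact: tree.
pose stuck d := [forall d', S d'.1 ==> ~~ follows d d'].
have unstuck d : ~~ stuck d -> exists2 d', S d'.1 & follows d d'.
  by rewrite negb_forall => /existsP[d']; rewrite negb_imply negbK => /andP[? ?]; exists d'.
have stuckP d : stuck d -> forall d', S d'.1 -> ~~ follows d d'.
  by move=> /forallP sd d' Sd'; have := sd d'; rewrite Sd'.
have [/existsP[d /andP[Sd sd]]|] := boolP [exists d, S d.1 && stuck d]; last first.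
  rewrite negb_exists => /forallP ns; exists (b, true) => // d Sd _.
  by apply: unstuck; have := ns d; rewrite Sd.
exists (dart_rev d) => // d' Sd'; rewrite dart_src_rev => d'd.
apply: unstuck; apply/negP => sd'.
have deg := deg1 d Sd (stuckP d sd); have deg' := deg1 d' Sd' (stuckP d' sd').
have ed : d'.1 = d.1.
  by move/card_le1_eqP: pend; apply; exact: pdt.
have [dd'|dd'] := same_edge_darts (esym ed); first by rewrite dd' eqxx in d'd.
move: deg deg'; rewrite dd' dart_tgt_rev {dd' ed d'd sd sd' Sd Sd'}.
case: d => e [] /=; rewrite /dart_tgt /dart_src/= => h1 h2.
  exact: (isolated_edge_compact h2 h1).
exact: (isolated_edge_compact h1 h2).
Qed.

End BoundState.

(** * Nonnegative multipliers and the energy inequality *)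
Section Energy.
Context {R : realType} (G : metric_graph R).
Notation mu := (@lebesgue_measure R).
Local Notation normc := ComplexField.Normc.normc.
Local Notation Re := (@complex.Re R).
Local Notation Im := (@complex.Im R).
Local Notation dsrc := (dart_src (@bsrc R G) (@btgt R G)).
Implicit Types (u du ddu : gfun G) (p lam : R).

Lemma dotC0 (z : R[i]) : dotC z 0 = 0.
Proof. by rewrite /dotC !mulr0 addr0. Qed.

Lemma dotCD (z t s : R[i]) : dotC z (t + s) = dotC z t + dotC z s.
Proof. by case: z t s => [a b] [c d] [e f]; rewrite /dotC/=; ring. Qed.

Lemma dotCN (z t : R[i]) : dotC z (- t) = - dotC z t.
Proof. by case: z t => [a b] [c d]; rewrite /dotC/=; ring. Qed.

(** Grouped by vertices, the boundary terms are the products of the value of u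
    at a vertex with its Kirchhoff sum. *)
Lemma boundary_flux u du (w : vertex G -> R[i]) :
  (forall v, kirchhoff_sum du v = 0) ->
  (forall b : bedge G, u (inl b) 0 = w (bsrc b)) ->
  (forall b : bedge G, u (inl b) (len b) = w (btgt b)) ->
  (forall h : hline G, u (inr h) 0 = w (hroot h)) ->
  \sum_b (flux (u (inl b)) (du (inl b)) (len b) - flux (u (inl b)) (du (inl b)) 0) +
  \sum_h - flux (u (inr h)) (du (inr h)) 0 = 0.
Proof.
move=> kir w0 wl wh.
suff -> : \sum_b (flux (u (inl b)) (du (inl b)) (len b) - flux (u (inl b)) (du (inl b)) 0) +
  \sum_h - flux (u (inr h)) (du (inr h)) 0 = - \sum_v dotC (w v) (kirchhoff_sum du v).
  by rewrite big1 ?oppr0// => v _; rewrite kir dotC0.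
have dsum z := big_morph (dotC z) (dotCD z) (dotC0 z).
under [in RHS]eq_bigr do rewrite kirchhoff_sum_darts dotCD !dsum.
rewrite [in RHS]big_split/= opprD; congr (_ + _).
  have -> : \sum_v \sum_(d | dsrc d == v) dotC (w v) (outgoing_deriv du d) =
      \sum_d dotC (w (dsrc d)) (outgoing_deriv du d).
    rewrite [RHS](partition_big dsrc xpredT)//=.
    by apply: eq_bigr => v _; apply: eq_bigr => d /eqP ->.
  transitivity (- \sum_b \sum_c dotC (w (dsrc (b, c))) (outgoing_deriv du (b, c))).
    rewrite -sumrN; apply: eq_bigr => b _; rewrite big_bool /outgoing_deriv /dart_src/=.
    by rewrite dotCN /flux /dotC -w0 -wl; ring.
  by rewrite pair_bigA/=; congr (- _); apply: eq_bigr => -[].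
rewrite sumrN; congr (- _).
rewrite (partition_big (@hroot R G) xpredT)//=.
apply: eq_bigr => v _; apply: eq_bigr => h /eqP <-.
by rewrite /flux wh.
Qed.

Lemma hline_flux p lam u du ddu h : 2 < p -> 0 <= lam -> in_H1 u ->
  NLS_solution p lam u du ddu ->
  (\int[mu]_(x in edge_itv (inr h : edge G)) (normc (du (inr h) x) ^+ 2)%:E <=
    (- flux (u (inr h)) (du (inr h)) 0)%:E)%E.
Proof.
move=> p2 lam0 uH sol.
have [sr si] := NLS_solution_hline h p2 sol.
have [ir ii] := in_L2_sqr_integrable (in_H1_in_L2 (inr h) uH).
have [_ cr] : {within `[0, +oo[, continuous (Re \o u (inr h))} /\
    {within `[0, +oo[, continuous (Re \o du (inr h))}.
  by apply: C1_on_halfline_continuous => T T0; have [] := sr T T0.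
have [_ ci] : {within `[0, +oo[, continuous (Im \o u (inr h))} /\
    {within `[0, +oo[, continuous (Im \o du (inr h))}.
  by apply: C1_on_halfline_continuous => T T0; have [] := si T T0.
rewrite integral_normc_sqr//; first last.
- exact: subspace_continuous_measurable_fun ci.
- exact: subspace_continuous_measurable_fun cr.
- exact: measurable_itv.
rewrite /flux /dotC opprD EFinD leeD//.
- exact: (halfline_energy lam0 sr ir).
- exact: (halfline_energy lam0 si ii).
Qed.

Lemma deriv_measurable p lam u du ddu e : 2 < p ->
  NLS_solution p lam u du ddu ->
  measurable_fun (edge_itv e) (fun x => Re (du e x)) /\
  measurable_fun (edge_itv e) (fun x => Im (du e x)).
Proof.
move=> p2 sol; case: e => [b|h].
  have [[[_ cr _] [_ ci _] _ _] _] := NLS_solution_segment b p2 sol.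
  split; (apply: subspace_continuous_measurable_fun; first exact: measurable_itv).
    exact: cr.
  exact: ci.
have [sr si] := NLS_solution_hline h p2 sol.
split; (apply: subspace_continuous_measurable_fun; first exact: measurable_itv).
- have [] // : {within `[0, +oo[, continuous (Re \o u (inr h))} /\
    {within `[0, +oo[, continuous (Re \o du (inr h))}.
  by apply: C1_on_halfline_continuous => T T0; have [] := sr T T0.
- have [] // : {within `[0, +oo[, continuous (Im \o u (inr h))} /\
    {within `[0, +oo[, continuous (Im \o du (inr h))}.
  by apply: C1_on_halfline_continuous => T T0; have [] := si T T0.
Qed.

Lemma segment_integral_lty (l : R) (f : R -> R) : {within `[0, l], continuous f} ->
  (\int[mu]_(x in `[0%R, l]) (f x)%:E < +oo)%E.
Proof.
move=> cf; apply: (integrable_lty (mu := mu)) => //.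
by apply: continuous_compact_integrable => //; exact: segment_compact.
Qed.

(** The Gagliardo-Nirenberg inequalities are stated for weak derivatives; this
    allows them to be used with the classical derivative of u. *)
Lemma nonnegative_multiplier_H1_deriv p lam u du ddu : 2 < p -> 0 <= lam -> in_H1 u ->
  NLS_solution p lam u du ddu -> H1_deriv u du.
Proof.
move=> p2 lam0 uH sol; have [_ [cu _]] := uH; split => // e.
have [mr mi] := deriv_measurable e p2 sol.
split; first exact: in_H1_in_L2.
  apply/(in_L2P mr mi); case: e mr mi => [b|h] mr mi.
    have [[[_ cr _] [_ ci _] _ _] _] := NLS_solution_segment b p2 sol.
    apply: segment_integral_lty.
    have -> : (fun x => normc (du (inl b) x) ^+ 2) =
      (fun x => Re (du (inl b) x) ^+ 2 + Im (du (inl b) x) ^+ 2).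
      by apply/funext => x; rewrite normc_sqr.
    by move=> x; apply: cvgD; apply: cvgM; (exact: cr || exact: ci).
  by apply: le_lt_trans (hline_flux h p2 lam0 uH sol) _; rewrite ltry.
case: e mr mi => [b|h] _ _.
  have [[r1 i1 _ _] _] := NLS_solution_segment b p2 sol.
  by split; apply: weak_derivR_segment => //; exact: len_gt0.
have [sr si] := NLS_solution_hline h p2 sol.
by split; apply: weak_derivR_halfline => T T0; [have [] := sr T T0|have [] := si T T0].
Qed.

(** Sum of [segment_energy] and [hline_flux] over the edges. *)
Lemma energy_le p lam u du ddu : 2 < p -> 0 <= lam -> in_H1 u ->
  NLS_solution p lam u du ddu -> (forall v, kirchhoff_sum du v = 0) ->
  (\sum_(e : edge G) \int[mu]_(x in edge_itv e) (normc (du e x) ^+ 2)%:E <=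
   \sum_(b : bedge G) \int[mu]_(x in `[0%R, len b]) (normc (u (inl b) x) `^ p)%:E)%E.
Proof.
move=> p2 lam0 uH sol kir; have [_ [[_ [w [w0 wl wh]]] _]] := uH.
rewrite big_sumType/=.
set K := (\sum_b \int[_]_(x in _) (_ `^ _)%:E)%E.
apply: (@le_trans _ _ (\sum_b ((flux (u (inl b)) (du (inl b)) (len b) -
   flux (u (inl b)) (du (inl b)) 0)%:E +
   \int[mu]_(x in `[0%R, len b]) (normc (u (inl b) x) `^ p)%:E) +
   \sum_h (- flux (u (inr h)) (du (inr h)) 0)%:E)%E).
  apply: leeD; apply: lee_sum => b _; last exact: hline_flux sol.
  have [s _] := NLS_solution_segment b p2 sol.
  exact: segment_energy (len_gt0 b) p2 lam0 s.
rewrite big_split/= -/K addeAC !sumEFin -EFinD.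
by rewrite (boundary_flux kir w0 wl wh) add0e.
Qed.

Lemma core_power_lty p u : 0 < p -> in_H1 u ->
  (\sum_(b : bedge G) \int[mu]_(x in `[0%R, len b]) (normc (u (inl b) x) `^ p)%:E < +oo)%E.
Proof.
move=> p0 [_ [[cu _] _]]; apply: lte_sum_pinfty => b _.
apply: segment_integral_lty; apply: continuous_onC_powR => //.
exact: (cu (inl b)).
Qed.

Lemma core_power_le_Linfty p m u : 0 < p -> 0 <= m -> in_H1 u ->
  (Linfty_graph u <= m%:E)%E ->
  (\sum_(b : bedge G) \int[mu]_(x in `[0%R, len b]) (normc (u (inl b) x) `^ p)%:E <=
    (core_length G * m `^ p)%:E)%E.
Proof.
move=> p0 m0 uH um.
rewrite /core_length mulr_suml -sumEFin; apply: lee_sum => b _.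
have [mr mi _] := in_H1_in_L2 (inl b) uH.
apply: le_trans (integral_normc_Linfty p0 m0 _ mr mi _) _ => //.
- exact: measurable_edge_itv.
- apply: le_trans um; rewrite /Linfty_graph.
  by rewrite (bigD1 (inl b))//= le_max lexx.
- by rewrite /edge_itv lebesgue_measure_itv/= lte_fin len_gt0 sube0 muleC -EFinM.
Qed.

Lemma Linfty0_mass u : in_H1 u -> (Linfty_graph u <= 0)%E -> (Lp_graph 2 u ^+ 2 = 0)%E.
Proof.
move=> uH u0; rewrite sqr_Lp_graph2 big1// => e _.
have [mr mi _] := in_H1_in_L2 e uH.
have h : (\int[mu]_(x in edge_itv e) (normc (u e x) `^ 2)%:E <=
    (0 `^ 2)%:E * mu (edge_itv e))%E.
  apply: integral_normc_Linfty => //; first exact: measurable_edge_itv.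
  by apply: le_trans u0; rewrite /Linfty_graph (bigD1 e)//= le_max lexx.
apply/eqP; rewrite eq_le; apply/andP; split; last first.
  by apply: integral_ge0 => x _; rewrite lee_fin sqr_ge0.
apply: le_trans (le_trans h _); last by rewrite powR0// mul0e.
rewrite le_eqVlt; apply/orP; left; apply/eqP; apply: eq_integral => x _.
by rewrite powR_mulrn ?normc_ge0.
Qed.
End Energy.

Theorem corollary3p8 (R : realType) (p mu Cp Cinf : R) (G : metric_graph R)
  (hCp : GN_constant p Cp) (hCinf : GN_infty_constant Cinf)
  (hnc : noncompact G) (htree : is_tree G) (hcore : nonempty_core G)
  (hpend : (#|pendants G| <= 1)%N)
  (hp4 : 4 <= p) (hp6 : p < 6) (hmu : 0 < mu)
  (hsmall : mu `^ ((p - 2) / (6 - p)) * core_length G <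
            Cinf `^ (- p) * Cp `^ ((4 - p) / (6 - p))) :
  ~ (exists u : gfun G, bound_state p mu u).
Proof.
move=> [u [[uH umass] [lam [du [ddu [d1 d2 nls kir]]]]]].
have sol : NLS_solution p lam u du ddu by [].
have p2 : 2 < p by lra.
have p0 : 0 < p by lra.
have [lam0|lam0] := leP lam 0.
  suff : (Lp_graph 2 u ^+ 2 = 0)%E by rewrite umass => -[] /eqP; rewrite gt_eqF.
  rewrite sqr_Lp_graph2 big1// => e _; apply: integral0_eq => x ex.
  suff -> : u e x = 0 by rewrite ComplexField.Normc.normc0 expr0n.
  case: e ex => [b|h] /= ex.
    have /asboolP h := nonpositive_multiplier_vanish b p2 lam0 hnc htree hpend uH sol kir.
    by have [] := h x ex.
  have [] // := hline_vanish h p2 lam0 uH sol (x := x).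
  by move: ex; rewrite /= in_itv/= andbT.
have {}lam0 := ltW lam0.
have kir' v : kirchhoff_sum du v = 0 by apply/kir/in_coreT.
have uduH := nonnegative_multiplier_H1_deriv p2 lam0 uH sol.
have en := energy_le p2 lam0 uH sol kir'.
have Kfin := core_power_lty p0 uH.
set D := (\sum_(e : edge G) _)%E in en; set K := (\sum_(b : bedge G) _)%E in en Kfin.
have D0 : (0 <= D)%E.
  by apply: sume_ge0 => e _; apply: integral_ge0 => x _; rewrite lee_fin sqr_ge0.
have Dfin : D \is a fin_num by rewrite ge0_fin_numE// (le_lt_trans en).
have Kf : K \is a fin_num by rewrite ge0_fin_numE// (le_trans D0).
set d := fine D; set k := fine K.
have d0 : 0 <= d by exact: fine_ge0.
have dk : d <= k by rewrite -lee_fin !fineK.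
have uE : (Lp_graph 2 u = (mu `^ 2^-1)%:E)%E.
  by rewrite Lp_graph2 -sqr_Lp_graph2 umass poweR_EFin.
have duE : (Lp_graph 2 du = (d `^ 2^-1)%:E)%E.
  by rewrite Lp_graph2 -/D -(fineK Dfin) poweR_EFin.
have [Cp0 GNp] := hCp; have [Ci0 GNi] := hCinf.
have {GNp} := GNp G hnc u du uduH; have {GNi} := GNi G hnc u du uduH.
rewrite uE duE !poweR_EFin -!EFinM => ui up.
set m := Cinf * _ * _ in ui.
have m0 : 0 <= m by rewrite !mulr_ge0 ?powR_ge0// ltW.
(* a zero Dirichlet energy would make the supremum norm of u vanish *)
have dpos : 0 < d.
  rewrite lt_neqAle d0 andbT; apply/eqP => d00.
  suff : (Lp_graph 2 u ^+ 2 = 0)%E by rewrite umass => -[] /eqP; rewrite gt_eqF.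
  apply: Linfty0_mass => //; apply: le_trans ui _.
  by rewrite /m -d00 powR0 ?powR0 ?mulr0// invr_eq0.
have k1 : k <= Cp * (mu `^ 2^-1) `^ (p / 2 + 1) * (d `^ 2^-1) `^ (p / 2 - 1).
  rewrite -lee_fin fineK//; apply: le_trans up.
  rewrite Lp_graph_powR// big_sumType/= leeDl//.
  by apply: sume_ge0 => h _; apply: integral_ge0 => x _; rewrite lee_fin powR_ge0.
have k2 : k <= core_length G * m `^ p.
  by rewrite -lee_fin fineK//; exact: core_power_le_Linfty.
have L0 : 0 < core_length G.
  have /card_gt0P[b _] := hcore.
  rewrite /core_length (bigD1 b)//= ltr_pwDl ?len_gt0//.
  by apply: sumr_ge0 => e _; rewrite ltW// len_gt0.
have := GN_incompatible hp4 hp6 hmu Cp0 Ci0 L0 dpos dk k1 k2.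
by rewrite leNgt hsmall.
Qed.
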